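(* Let $\mathbf u\in H_e^1$, let $g=\mathcal M\mathbf u$, and set $h:=-\nabla\!\cdot\mathbf u$. Then $$\frac1{4\pi r^2}\frac{\partial}{\partial r}\left(r^4g(\mathbf x',r)\right)=\mathcal Rh(\mathbf x',r)$$ for almost every $(\mathbf x',r)\in\mathbb R^2\times(0,\infty)$, the radial derivative being understood weakly.
   Context: Write $\mathbf x=(\mathbf x',x_3)\in\mathbb R^3$ with $\mathbf x'=(x_1,x_2)$. $B(\mathbf x',r)$ is the open ball in $\mathbb R^3$ with center $(\mathbf x',0)$ and radius $r$. Symmetry class: $\sigma(\mathbf x',x_3)=(\mathbf x',-x_3)$, $J=\operatorname{diag}(1,1,-1)$, and $H_e^1=\{\mathbf u\in H^1(\mathbb R^3;\mathbb R^3):\mathbf u(\sigma\mathbf x)=J\mathbf u(\mathbf x)\text{ for a.e. }\mathbf x\}$, with $H^1$ the usual $L^2$-based Sobolev space of real vector fields. Forward operator: for $\mathbf u\in H_e^1$, $$(\mathcal M\mathbf u)(\mathbf x',r)=-\frac1{r^4}\int_{B(\mathbf x',r)}\nabla\!\cdot\mathbf u(\mathbf y)\,d\mathbf y,\qquad(\mathbf x',r)\in\mathbb R^2\times(0,\infty).$$ Wall-centered spherical mean: for $h\in L^1_{\mathrm{loc}}(\mathbb R^3)$, $\mathcal Rh(\mathbf x',r)=\frac1{4\pi r^2}\int_{\partial B(\mathbf x',r)}h(\mathbf y)\,dS(\mathbf y)$, defined for almost every $r>0$, where $dS$ is surface measure. *)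

(* Defs.v *)
From HB Require Import structures.
From mathcomp Require Import all_boot all_order all_algebra.
From mathcomp Require Import all_classical all_reals all_analysis.

Set Implicit Arguments.
Unset Strict Implicit.
Unset Printing Implicit Defensive.

Import Order.TTheory GRing.Theory Num.Theory.
Import numFieldNormedType.Exports.

Local Open Scope classical_set_scope.
Local Open Scope ring_scope.

(* A point (x', x_3) of R^3 is the pair of x' : R * R and x_3.  The same type
   carries the data variables (x', r). *)
Notation R3 R := (R * R * R)%type.

(* The library puts lebesgue_measure on measurableTypeR R, an alias of R with
   its Borel sets, so the measures on the products need the alias. *)
Notation M2 R := (measurableTypeR R * measurableTypeR R)%type.
Notation M3 R := (M2 R * measurableTypeR R)%type.

Section Space.
Context {R : realType}.
Implicit Types (x : R3 R) (f v phi h : R3 R -> R) (u : R3 R -> R3 R).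

Definition mu2 : {measure set (M2 R) -> \bar R} :=
  (@lebesgue_measure R \x @lebesgue_measure R)%E.

Definition mu3 : {measure set (M3 R) -> \bar R} :=
  (@lebesgue_measure R \x @lebesgue_measure R \x @lebesgue_measure R)%E.

Definition coord3 (i : 'I_3) x : R :=
  match val i with 0%N => x.1.1 | 1%N => x.1.2 | _ => x.2 end.

Definition unit_vec (i : 'I_3) : R3 R :=
  ((i == 0)%:R, (i == 1)%:R, (i == 2)%:R).

Definition axis3 : 'I_3 := 2.

Definition partial (i : 'I_3) f : R3 R -> R := 'D_(unit_vec i) f.

Definition partials (s : seq 'I_3) f : R3 R -> R := foldr partial f s.

(* C^oo: the partial derivatives of all orders exist and are continuous. *)
Definition smooth f :=
  forall s : seq 'I_3, continuous (partials s f) /\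
    forall i x, derivable (partials s f) x (unit_vec i).

(* C_c^oo(Omega), its elements being extended by 0 outside Omega. *)
Definition test_function (Omega : set (R3 R)) phi :=
  smooth phi /\
  exists K, [/\ compact K, K `<=` Omega & forall x, ~ K x -> phi x = 0].

Definition L1loc (Omega : set (R3 R)) f :=
  measurable_fun (Omega : set (M3 R)) f /\
  forall K, K `<=` Omega -> compact K ->
    (\int[mu3]_(x in K) `|f x|%:E < +oo)%E.

Definition is_weak_partial (Omega : set (R3 R)) (i : 'I_3) f v :=
  [/\ L1loc Omega f, L1loc Omega v &
    forall phi, test_function Omega phi ->
      \int[mu3]_(x in Omega) (f x * partial i phi x) =
      - \int[mu3]_(x in Omega) (v x * phi x)].

(* Some representative of the weak partial derivative on R^3, which is unique
   almost everywhere; 0 is a junk value for f without weak derivative. *)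
Definition weak_partial (i : 'I_3) f : R3 R -> R :=
  xget (fun=> 0) [set v | is_weak_partial setT i f v].

Definition H1 u :=
  forall i : 'I_3,
    (fun x => coord3 i (u x)) \in Lfun mu3 2%:E /\
    forall j : 'I_3, exists2 v,
      v \in Lfun mu3 2%:E & is_weak_partial setT j (fun x => coord3 i (u x)) v.

Definition sigma x : R3 R := (x.1, - x.2).

(* The matrix diag(1, 1, -1) acting on vectors. *)
Definition J (w : R3 R) : R3 R := (w.1.1, w.1.2, - w.2).

Definition H1e u := H1 u /\ {ae mu3, forall x, u (sigma x) = J (u x)}.

Definition weak_div u x : R :=
  \sum_(i < 3) weak_partial i (fun y => coord3 i (u y)) x.

Definition wall_ball (x' : R * R) (r : R) : set (R3 R) :=
  [set y | 0 < r /\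
    (y.1.1 - x'.1) ^+ 2 + (y.1.2 - x'.2) ^+ 2 + y.2 ^+ 2 < r ^+ 2].

Definition forward u (p : R3 R) : R :=
  - (p.2 ^+ 4)^-1 * \int[mu3]_(y in wall_ball p.1 p.2) weak_div u y.

Definition cross (a b : R3 R) : R3 R :=
  (a.1.2 * b.2 - a.2 * b.1.2,
   a.2 * b.1.1 - a.1.1 * b.2,
   a.1.1 * b.1.2 - a.1.2 * b.1.1).

Definition enorm (a : R3 R) : R :=
  Num.sqrt (a.1.1 ^+ 2 + a.1.2 ^+ 2 + a.2 ^+ 2).

Definition derive_vec (c : R -> R3 R) (t : R) : R3 R :=
  (derive1 (fun s => (c s).1.1) t, derive1 (fun s => (c s).1.2) t,
   derive1 (fun s => (c s).2) t).

(* The surface integral of h over the surface parametrized by Phi on D: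
   dS = |d_1 Phi x d_2 Phi| dt. *)
Definition surface_integral (D : set (R * R)) (Phi : R * R -> R3 R) h : \bar R :=
  (\int[mu2]_(t in D)
     (h (Phi t) * enorm (cross (derive_vec (fun s => Phi (s, t.2)) t.1)
                               (derive_vec (fun s => Phi (t.1, s)) t.2)))%:E)%E.

(* Spherical coordinates (polar angle, azimuth) on the boundary of
   [wall_ball x' r]; the area element is r ^+ 2 * sin t.1. *)
Definition sphere_param (x' : R * R) (r : R) (t : R * R) : R3 R :=
  (x'.1 + r * sin t.1 * cos t.2, x'.2 + r * sin t.1 * sin t.2, r * cos t.1).

Definition sphere_dom : set (R * R) :=
  `[0, (pi : R)]%classic `*` `[0, (2 * pi : R)]%classic.

(* Extended-real valued: for measurable h, a finite value means that h is
   integrable over the sphere, since an integral whose positive and negative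
   parts are both infinite takes the value -oo in the library. *)
Definition spherical_mean h (x' : R * R) (r : R) : \bar R :=
  ((4 * pi * r ^+ 2)^-1%:E *
   surface_integral sphere_dom (sphere_param x' r) h)%E.

Definition data_domain : set (R3 R) := [set p | 0 < p.2].

End Space.

(* Main.v *)
Require Import Defs.
From HB Require Import structures.
From mathcomp Require Import all_boot all_order all_algebra.
From mathcomp Require Import all_classical all_reals all_analysis.
From mathcomp Require Import measurable_realfun ring lra.

Set Implicit Arguments.
Unset Strict Implicit.
Unset Printing Implicit Defensive.

Import Order.TTheory GRing.Theory Num.Theory.
Import numFieldNormedType.Exports.

Local Open Scope classical_set_scope.
Local Open Scope ring_scope.

(** Put [F(x', r) = r ^+ 4 * g(x', r)].  For [r > 0] the powers of [r] cancel
    and [F(x', r)] is the integral of [h] over the ball [wall_ball x' r].  In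
    spherical coordinates about [(x', 0)] this reads
    [F(x', r) = \int_0^r s(x', rho) drho], where [s(x', rho)] is the integral of
    [h] over the sphere of radius [rho], that is [4 * pi * rho ^+ 2] times the
    spherical mean.  So [F] is a primitive in [r] of the locally integrable
    function [s], hence has [s] as weak radial derivative.  Sobolev regularity
    of the field enters through the measurability and local integrability of its
    divergence.

    Two results carry this.

    [ge0_spherical] is the change to spherical coordinates for nonnegative
    measurable integrands.  It is polar coordinates used twice: in the
    horizontal plane, and then in the half-plane of the height [x_3] and the
    distance to the vertical axis.  Polar coordinates in a half-plane
    ([ge0_polar_half_plane]) reduce to substitutions in one variable separated
    by Tonelli's theorem: at fixed [x] one replaces [y > 0] by
    [rho = sqrt (x ^+ 2 + y ^+ 2)], and then at fixed [rho] one replaces [x] by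
    [rho * cos theta].  As [h] is only measurable, the substitution rule in one
    variable is proved as an equality of measures, checked on rays by the
    fundamental theorem of calculus ([ge0_change_of_variable]).

    [weak_partial_primitive] says that a vertical primitive of a function that
    is integrable on boxes has that function as weak vertical derivative.  On
    almost every vertical line this is integration by parts against a compactly
    supported function, which is Fubini's theorem on a triangle
    ([integral_primitive_derive]).

    The remaining care is about null sets and signs.  The positive and negative
    parts of [h] are integrated over spheres separately ([shell]); both
    integrals are finite for almost every [(x', r)] because they are integrable
    on boxes ([shell_half_box]), and there their difference is at once the weak
    derivative and the surface integral of [h]. *)

(** * Iterated integrals *)

Section product_sigma_finite.
Context d1 d2 (T1 : measurableType d1) (T2 : measurableType d2) (R : realType).
Variables (m1 : {sigma_finite_measure set T1 -> \bar R})
  (m2 : {sigma_finite_measure set T2 -> \bar R}).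

Lemma sigma_finite_product : sigma_finite setT (m1 \x m2)%E.
Proof.
have /sigma_finiteP[F [TF ndF Foo]] := sigma_finiteT m1.
have /sigma_finiteP[G [TG ndG Goo]] := sigma_finiteT m2.
exists (fun n => F n `*` G n).
  rewrite -setXTT TF TG predeqE => -[x y]; split; last first.
    by move=> [n _ []/= ? ?]; split; exists n.
  move=> [/= [n _ Fnx] [k _ Gky]]; exists (maxn n k) => //; split.
  - by move: x Fnx; exact/subsetPset/ndF/leq_maxl.
  - by move: y Gky; exact/subsetPset/ndG/leq_maxr.
move=> k; have [? ?] := Foo k; have [? ?] := Goo k.
split; first exact: measurableX.
by rewrite product_measure1E// lte_mul_pinfty// ge0_fin_numE.
Qed.

(** A copy of the product measure on which the structure of sigma-finite measure
    is found by inference, so that the theorems of Fubini and Tonelli can be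
    iterated in three variables. *)
Definition sf_product : set (T1 * T2) -> \bar R := (m1 \x m2)%E.

HB.instance Definition _ := Measure.on sf_product.
HB.instance Definition _ :=
  Measure_isSigmaFinite.Build _ _ _ sf_product sigma_finite_product.

End product_sigma_finite.

Section sections.
Context d1 d2 (T1 : measurableType d1) (T2 : measurableType d2) (R : realType).
Variables (m1 : {sigma_finite_measure set T1 -> \bar R})
  (m2 : {sigma_finite_measure set T2 -> \bar R}).
Local Open Scope ereal_scope.

(** Tonelli's theorem on a domain that need not be a rectangle. *)
Lemma ge0_fubini_sections (A : set (T1 * T2)) (f : T1 * T2 -> \bar R) :
  measurable A -> measurable_fun setT f -> (forall z, 0 <= f z) ->
  \int[m1]_x \int[m2]_(y in xsection A x) f (x, y) =
  \int[m2]_y \int[m1]_(x in ysection A y) f (x, y).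
Proof.
move=> mA mf f0.
transitivity (\int[m1]_x \int[m2]_y (f \_ A) (x, y)).
  apply: eq_integral => x _; rewrite integral_mkcond; apply: eq_integral => y _.
  by rewrite !patchE mem_xsection.
rewrite (fubini_tonelli (f \_ A)).
- apply: eq_integral => y _; rewrite [RHS]integral_mkcond.
  by apply: eq_integral => x _; rewrite !patchE mem_ysection.
- by apply/(measurable_restrictT _ mA); exact: measurable_funTS.
- by move=> z; rewrite patchE; case: ifP.
Qed.

End sections.

Section setX_integrals.
Context d1 d2 (T1 : measurableType d1) (T2 : measurableType d2) (R : realType).
Variables (m1 : {sigma_finite_measure set T1 -> \bar R})
  (m2 : {sigma_finite_measure set T2 -> \bar R}).
Local Open Scope ereal_scope.

Lemma ge0_integral_setX (A : set T1) (B : set T2) (f : T1 * T2 -> \bar R) :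
  measurable A -> measurable B ->
  measurable_fun setT f -> (forall z, 0 <= f z) ->
  \int[m1 \x m2]_(z in A `*` B) f z =
  \int[m1]_(x in A) \int[m2]_(y in B) f (x, y).
Proof.
move=> mA mB mf f0; rewrite integral_mkcond fubini_tonelli1.
- rewrite [RHS]integral_mkcond; apply: eq_integral => x _; rewrite patchE.
  case: ifPn => xA.
    rewrite [RHS]integral_mkcond; apply: eq_integral => y _.
    by rewrite !patchE in_setX xA.
  by apply: integral0_eq => y _; rewrite patchE in_setX (negbTE xA).
- apply/(measurable_restrictT _ (measurableX mA mB)).
  exact: measurable_funTS.
- by move=> z; rewrite patchE; case: ifP.
Qed.

Lemma measurable_section_integral (B : set T2) (f : T1 * T2 -> \bar R) :
  measurable B -> measurable_fun setT f -> (forall z, 0 <= f z) ->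
  measurable_fun setT (fun x => \int[m2]_(y in B) f (x, y)).
Proof.
move=> mB mf f0.
rewrite (_ : (fun _ => _) = fubini_F m2 (f \_ (setT `*` B))).
  apply: measurable_fun_fubini_tonelli_F.
    apply/(measurable_restrictT _ (measurableX measurableT mB)).
    exact: measurable_funTS.
  by move=> z; rewrite patchE; case: ifP.
apply/funext => x; rewrite integral_mkcond; apply: eq_integral => y _.
by rewrite !patchE in_setX in_setT.
Qed.

End setX_integrals.

Section measurable_integral.
Context d1 d2 (T1 : measurableType d1) (T2 : measurableType d2) (R : realType).
Variable m2 : {sigma_finite_measure set T2 -> \bar R}.
Local Open Scope ereal_scope.

(** The integral is the difference of those of the positive and negative parts
    everywhere, with the value [-oo] where both are infinite. *)
Lemma measurable_integral (f : T1 * T2 -> \bar R) : measurable_fun setT f ->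
  measurable_fun setT (fun x => \int[m2]_y f (x, y)).
Proof.
move=> mf; rewrite (_ : (fun _ => _) =
    fubini_F m2 f^\+ \- fubini_F m2 f^\-); last first.
  apply/funext => x; rewrite [LHS]integralE /fubini_F; congr (_ - _).
    by apply: eq_integral => y _; rewrite !funeposE.
  by apply: eq_integral => y _; rewrite !funenegE.
apply: emeasurable_funB; apply: measurable_fun_fubini_tonelli_F => //.
  exact: measurable_funepos.
exact: measurable_funeneg.
Qed.

End measurable_integral.

(** * Substitution on the line *)

Section restriction.
Context d (T : measurableType d) (R : realType).
Variables (mu : {measure set T -> \bar R}) (D : set T) (mD : measurable D).

Lemma ge0_integral_mrestr (f : T -> \bar R) :
  measurable_fun setT f -> (forall x, 0 <= f x)%E ->
  (\int[mrestr mu mD]_x f x = \int[mu]_(x in D) f x)%E.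
Proof.
move=> mf f0; rewrite -(setUv D) ge0_integral_setU//; last 3 first.
- exact: measurableC.
- by rewrite setUv.
- by apply/disj_setPS; rewrite setICr.
rewrite [X in (_ + X)%E]null_set_integral ?adde0//; last 3 first.
- exact: measurableC.
- exact: measurable_funTS.
- by rewrite /= /mrestr setICl measure0.
by apply: eq_measure_integral => A mA AD; rewrite /= /mrestr setIidl.
Qed.

End restriction.

Section density.
Context (R : realType).
Notation mu := (@lebesgue_measure R).
Variables (D : set R) (G g : R -> R).
Hypotheses (mD : measurable D) (mG : measurable_fun setT G)
  (mg : measurable_fun setT g) (g0 : forall t, D t -> 0 <= g t).

Definition subgraph : set (M2 R) := [set z | D z.1 /\ 0 <= z.2 < g z.1].

Lemma measurable_subgraph : measurable subgraph.
Proof.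
have -> : subgraph = (D `*` setT) `&` ((setT `*` `[0, +oo[) `&`
    [set z | 0 < g z.1 - z.2]).
  apply/seteqP; split=> z /=; rewrite in_itv/= andbT subr_gt0.
    by move=> [Dz /andP[]]; split.
  by move=> [[Dz _] [[_ z0] zg]]; split=> //; apply/andP.
apply: measurableI; first exact: measurableX.
apply: measurableI; first exact: measurableX.
have mF : measurable_fun setT (fun z : M2 R => g z.1 - z.2).
  apply: measurable_funB; last exact: measurable_snd.
  by apply: measurableT_comp mg _; exact: measurable_fst.
rewrite -[X in measurable X]setTI.
have -> : [set z : M2 R | 0 < g z.1 - z.2] =
    (fun z : M2 R => g z.1 - z.2) @^-1` `]0, +oo[.
  by apply/seteqP; split=> z /=; rewrite in_itv/= andbT.
exact: mF.
Qed.

Definition base_map (z : M2 R) : measurableTypeR R := G z.1.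

Lemma measurable_base_map : measurable_fun setT base_map.
Proof. by apply: measurableT_comp mG _; exact: measurable_fst. Qed.

(** The image under [G] of the measure with density [g] on [D]: since [g] is the
    length of the vertical sections of its subgraph, this is an image of the
    planar measure of the subgraph, and sigma-additivity comes for free. *)
Definition density_image : {measure set (measurableTypeR R) -> \bar R}.
Proof.
refine (pushforward (mrestr (@mu2 R) measurable_subgraph) base_map).
exact: measurable_base_map.
Defined.

Lemma ge0_integral_density_image (f : R -> \bar R) : measurable_fun setT f ->
  (forall x, 0 <= f x)%E ->
  (\int[density_image]_x f x = \int[mu]_(t in D) (f (G t) * (g t)%:E))%E.
Proof.
move=> mf f0.
have mGf := measurable_base_map.
rewrite /density_image.
transitivity (\int[mrestr (@mu2 R) measurable_subgraph]_z f (G z.1))%E.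
  by rewrite (ge0_integral_pushforward mGf).
rewrite ge0_integral_mrestr//=; last first.
  by apply: measurableT_comp mf _.
rewrite integral_mkcond.
have := (@fubini_tonelli1 _ _ _ _ _ lebesgue_measure lebesgue_measure
  ((fun z => f (G z.1)) \_ subgraph)).
move=> -> //; last 2 first.
  apply/(measurable_restrictT _ measurable_subgraph).
  by apply: measurable_funTS; apply: measurableT_comp mf _.
  by move=> z; rewrite patchE; case: ifP.
rewrite [RHS]integral_mkcond; apply: eq_integral => t _.
rewrite /fubini_F [RHS]patchE; case: ifPn => tD.
  transitivity (\int[mu]_(s in `[0%R, g t[) (cst (f (G t)) s))%E.
    rewrite [RHS]integral_mkcond; apply: eq_integral => s _.
    rewrite !patchE; congr (if _ then _ else _).
    apply/idP/idP; rewrite !inE/= in_itv/=; first by case.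
    by split=> //; rewrite -in_setE.
  rewrite integral_cst// [X in (_ * X)%E]lebesgue_measure_itv/= lte_fin.
  have := g0 (set_mem tD); rewrite le_eqVlt => /predU1P[<-|->].
    by rewrite ltxx.
  by rewrite -EFinD subr0.
apply: integral0_eq => s _; rewrite patchE ifF//; apply/negbTE.
by rewrite notin_setE => -[/= Dt _]; move/negP: tD; rewrite in_setE.
Qed.

Variable E : set R.
Hypothesis mE : measurable E.
Hypothesis rays : forall d,
  (\int[mu]_(t in D `&` G @^-1` `]-oo, d[) (g t)%:E = mu (E `&` `]-oo, d[))%E.
Hypothesis rays_fin : forall d, (mu (E `&` `]-oo, d[) < +oo)%E.

(** Both sides are integrals of [f] against measures that agree on the rays
    [`]-oo, d[], which are stable by intersection, cover the line and generate
    the Borel sets; finiteness on rays makes the two measures equal. *)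
Lemma ge0_change_of_variable (f : R -> \bar R) : measurable_fun setT f ->
  (forall x, 0 <= f x)%E ->
  (\int[mu]_(x in E) f x = \int[mu]_(t in D) (f (G t) * (g t)%:E))%E.
Proof.
move=> mf f0.
rewrite -ge0_integral_density_image// -(ge0_integral_mrestr mu mE)//.
have ray_eq d :
    density_image `]-oo, d[%classic = mrestr mu mE `]-oo, d[%classic.
  have -> : (density_image `]-oo, d[%classic =
      \int[density_image]_x (\1_(`]-oo, d[%classic) x)%:E)%E.
    by rewrite integral_indic// setIT.
  rewrite ge0_integral_density_image//; last first.
    exact/measurable_EFinP/measurable_indic.
  rewrite /= /mrestr setIC -rays integral_mkcondr; apply: eq_integral => t _.
  rewrite patchE indicE (_ : (t \in G @^-1` _) = (G t \in `]-oo, d[%classic)).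
    by case: ifP => _; rewrite ?mul1e ?mul0e.
  by apply/idP/idP; rewrite !inE.
apply: eq_measure_integral => A mA _.
have Gm : @RGenInftyO.G R `<=` @measurable _ (measurableTypeR R).
  by move=> _ [x ->].
apply/esym; apply: (@g_sigma_algebra_measure_unique _ R (measurableTypeR R)
  (@RGenInftyO.G R) Gm (fun n => `]-oo, n%:R[%classic)).
- by move=> n; exists n%:R.
- rewrite -subTset => x _; exists (Num.trunc x).+1 => //=.
  by rewrite in_itv/= truncnS_gt.
- move=> _ _ [x ->] [y ->]; exists (Num.min x y).
  by apply/seteqP; split=> z/=; rewrite !in_itv/= lt_min => /andP.
- by move=> _ [x ->]; exact: ray_eq.
- by move=> n; rewrite ray_eq /= /mrestr setIC.
- have -> : <<s RGenInftyO.G (R:=R) >> = (@ocitv R).-sigma.-measurable.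
    by rewrite RGenInftyO.measurableE.
  exact: mA.
Qed.

End density.

Section substitution.
Context (R : realType).
Notation mu := (@lebesgue_measure R).
Variables (G g : R -> R).
Hypotheses (dG : forall x : R, is_derive x (1 : R) G (g x)) (cg : continuous g).

Lemma continuous_primitive : continuous G.
Proof.
move=> x; apply: differentiable_continuous; apply/derivable1_diffP.
by case: (dG x).
Qed.

Lemma integral_bndo_derive a c : a <= c ->
  (\int[mu]_(t in `[a, c[) (g t)%:E = (G c - G a)%:E)%E.
Proof.
have mg : measurable_fun setT (EFin \o g).
  by apply/measurable_EFinP; exact: continuous_measurable_fun.
rewrite le_eqVlt => /predU1P[->|ac].
  by rewrite set_itvco0 integral_set0 subrr.
have cG := continuous_primitive.
rewrite integral_itv_bndo_bndc; last exact: measurable_funTS.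
rewrite (@continuous_FTC2 _ g G)//.
- exact: continuous_subspaceT.
- split.
  + by move=> x _; case: (dG x).
  + exact/cvg_at_right_filter/cG.
  + exact/cvg_at_left_filter/cG.
- by move=> x _; rewrite derive1E; case: (dG x).
Qed.

Variable f : R -> \bar R.
Hypotheses (mf : measurable_fun setT f) (f0 : forall x, (0 <= f x)%E).

Let mG : measurable_fun setT G.
Proof. by apply: continuous_measurable_fun; exact: continuous_primitive. Qed.

Let mg : measurable_fun setT g.
Proof. exact: continuous_measurable_fun. Qed.

(** By [ge0_change_of_variable] it is enough to treat rays.  The part of
    [`[a, b]] that an increasing [G] sends below [d] is empty, everything, or
    [`[a, c[] with [G c = d]; the last case is the fundamental theorem of
    calculus. *)
Lemma ge0_substitution_cc a b : a <= b ->
  {in `[a, b] &, {homo G : x y / x < y}} ->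
  (forall t, t \in `[a, b] -> 0 <= g t) ->
  (\int[mu]_(x in `[G a, G b]) f x =
   \int[mu]_(t in `[a, b]) (f (G t) * (g t)%:E))%E.
Proof.
move=> ab /le_mono_in GG g0.
have aI : a \in `[a, b] by rewrite in_itv/= lexx.
have bI : b \in `[a, b] by rewrite in_itv/= ab lexx.
have fin d : (mu (`[G a, G b] `&` `]-oo, d[) < +oo)%E.
  apply: (@le_lt_trans _ _ (mu `[G a, G b])).
    by apply: le_measure; rewrite ?inE//; exact: measurableI.
  by rewrite lebesgue_measure_itv; case: ifP => //= _; rewrite -EFinB ltry.
apply: ge0_change_of_variable => // d.
have [dGa|Gad] := leP d (G a).
  rewrite (_ : _ `&` _ = set0) ?integral_set0; last first.
    apply/seteqP; split=> t //= []; rewrite !in_itv/= => tI tG.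
    have : G a <= G t by rewrite GG//; case/andP: tI.
    by rewrite leNgt (lt_le_trans tG).
  rewrite (_ : _ `&` _ = set0) ?measure0//.
  apply/seteqP; split=> t //= []; rewrite !in_itv/= => /andP[tI _] tG.
  by move: tI; rewrite leNgt (lt_le_trans tG).
have [Gbd|dGb] := ltP (G b) d.
  rewrite setIidl; last first.
    move=> t /=; rewrite !in_itv/= => tI; apply: le_lt_trans Gbd.
    by rewrite GG//; case/andP: tI.
  rewrite setIidl; last first.
    by move=> t /=; rewrite !in_itv/= => /andP[_ tI]; exact: le_lt_trans Gbd.
  rewrite -integral_itv_bndo_bndc; last first.
    exact/measurable_funTS/measurable_EFinP.
  rewrite integral_bndo_derive// lebesgue_measure_itv/= lte_fin lt_neqAle.
  rewrite (GG _ _ aI bI) ab andbT; case: eqP => [->|]//=.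
  by rewrite subrr.
have [c cI Gc] : exists2 c, c \in `[a, b] & G c = d.
  apply: IVT => //; first exact/continuous_subspaceT/continuous_primitive.
  by rewrite ge_min le_max (ltW Gad) dGb orbT.
have [ac cb] : a <= c /\ c <= b by move: cI; rewrite in_itv/= => /andP.
rewrite (_ : `[a, b] `&` _ = `[a, c[%classic); last first.
  apply/seteqP; split=> t /=; rewrite !in_itv/=.
    move=> [tI]; rewrite -Gc; case/andP: (tI) => -> _ /=.
    by apply: contraLR; rewrite -!leNgt => ct; rewrite GG.
  move=> /andP[ta tc]; have tI : t \in `[a, b].
    by rewrite in_itv/= ta (le_trans (ltW tc)).
  split; first by rewrite ta (le_trans (ltW tc)).
  by rewrite -Gc (leW_mono_in GG).
rewrite (_ : `[G a, G b] `&` _ = `[G a, d[%classic); last first.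
  apply/seteqP; split=> t /=; rewrite !in_itv/=.
    by move=> [/andP[-> _]].
  by move=> /andP[ta td]; rewrite ta td (le_trans (ltW td)).
by rewrite integral_bndo_derive// Gc lebesgue_measure_itv/= lte_fin Gad.
Qed.

Lemma ge0_substitution_cy a :
  {in `[a, +oo[ &, {homo G : x y / x < y}} ->
  (forall t, a <= t -> 0 <= g t) -> (forall d, exists2 t, a <= t & d <= G t) ->
  (\int[mu]_(x in `[G a, +oo[) f x =
   \int[mu]_(t in `[a, +oo[) (f (G t) * (g t)%:E))%E.
Proof.
move=> /le_mono_in GG g0 Goo.
have GE t : `[G a, +oo[ `&` `]-oo, t[ = `[G a, t[%classic.
  by apply/seteqP; split=> s /=; rewrite !in_itv/= andbT => /andP.
have aI : a \in `[a, +oo[ by rewrite in_itv/= lexx.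
have fin d : (mu (`[G a, +oo[ `&` `]-oo, d[) < +oo)%E.
  by rewrite GE lebesgue_measure_itv; case: ifP => //= _; rewrite -EFinB ltry.
apply: ge0_change_of_variable => //.
  by move=> t /=; rewrite in_itv/= andbT => /g0.
move=> d; rewrite GE; have [dGa|Gad] := leP d (G a).
  rewrite (_ : _ `&` _ = set0) ?integral_set0; last first.
    apply/seteqP; split=> t //= []; rewrite !in_itv/= => tI tG.
    have : G a <= G t by rewrite GG ?in_itv//=; case/andP: tI.
    by rewrite leNgt (lt_le_trans tG).
  by rewrite lebesgue_measure_itv/= lte_fin ltNge dGa.
have [b ab dGb] := Goo d.
have [c cI Gc] : exists2 c, c \in `[a, b] & G c = d.
  apply: IVT => //; first exact/continuous_subspaceT/continuous_primitive.
  by rewrite ge_min le_max (ltW Gad) dGb orbT.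
have [ac _] : a <= c /\ c <= b by move: cI; rewrite in_itv/= => /andP.
have cJ : c \in `[a, +oo[ by rewrite in_itv/= ac.
rewrite (_ : `[a, +oo[ `&` _ = `[a, c[%classic); last first.
  apply/seteqP; split=> t /=; rewrite !in_itv/= ?andbT.
    move=> [tI]; rewrite -Gc (tI) /=.
    by apply: contraLR; rewrite -!leNgt => ct; rewrite GG// in_itv/= tI.
  move=> /andP[ta tc]; have tI : t \in `[a, +oo[ by rewrite in_itv/= ta.
  split=> //.
  by rewrite -Gc (leW_mono_in GG).
by rewrite integral_bndo_derive// Gc lebesgue_measure_itv/= lte_fin Gad.
Qed.

End substitution.

Section affine.
Context (R : realType).
Notation mu := (@lebesgue_measure R).
Variable f : R -> \bar R.
Hypotheses (mf : measurable_fun setT f) (f0 : forall x, (0 <= f x)%E).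

Lemma ge0_integral_shift a : (\int[mu]_x f (x + a)%R = \int[mu]_x f x)%E.
Proof.
have ma : measurable_fun setT
    ((fun x => x + a) : measurableTypeR R -> measurableTypeR R).
  exact: measurable_funD.
transitivity (\int[pushforward mu
    ((fun x => (x + a)%R) : measurableTypeR R -> measurableTypeR R)]_x f x)%E.
  by rewrite (ge0_integral_pushforward ma).
apply: eq_measure_integral => A mA _.
apply/esym/lebesgue_measure_unique => //= _ [[b c]] _ <-.
rewrite /pushforward/= (_ : _ @^-1` _ = `]b - a, c - a]%classic).
  rewrite !lebesgue_measure_itv/= !lte_fin ltrD2r -!EFinB.
  by case: ifP => // _; congr (_%:E); ring.
by apply/seteqP; split=> x /=; rewrite !in_itv/= ltrBlDr lerBrDr.
Qed.

Lemma ge0_integral_opp : (\int[mu]_x f (- x)%R = \int[mu]_x f x)%E.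
Proof.
have mN : measurable_fun setT
    (-%R : measurableTypeR R -> measurableTypeR R).
  exact: measurable_funN.
transitivity (\int[pushforward mu
    (-%R : measurableTypeR R -> measurableTypeR R)]_x f x)%E.
  by rewrite (ge0_integral_pushforward mN).
by apply: eq_measure_integral => A mA _; exact: lebesgue_measureN.
Qed.

End affine.

(** * Polar and spherical coordinates *)

Section measurable_algebraic.
Context (R : realType).

Lemma measurable_sqrt : measurable_fun setT (Num.sqrt : R -> R).
Proof. by apply: continuous_measurable_fun; exact: sqrt_continuous. Qed.

Lemma measurable_invr : measurable_fun setT (fun x : R => x^-1).
Proof.
(* powR is only meaningful on nonnegative bases, hence the square. *)
rewrite (_ : (fun _ => _) = fun x : R => x * powR (x ^+ 2) (-1)).
  apply: measurable_funM => //.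
  by apply: measurableT_comp (measurable_powR _) _.
apply/funext => x; rewrite powR_inv1 ?sqr_ge0//.
have [->|x0] := eqVneq x 0; first by rewrite invr0 mul0r.
by field.
Qed.

End measurable_algebraic.

Section slice.
Context (R : realType).
Notation mu := (@lebesgue_measure R).
Variable x : R.
Hypothesis x0 : x != 0.
Let G (y : R) := Num.sqrt (x ^+ 2 + y ^+ 2).

Lemma hypot_gt0 y : 0 < G y.
Proof.
by rewrite sqrtr_gt0 ltr_wpDr ?sqr_ge0// lt_neqAle eq_sym sqrf_eq0 x0 sqr_ge0.
Qed.

Lemma is_derive_hypot (y : R) : is_derive y (1 : R) G (y / G y).
Proof.
have s0 : 0 < x ^+ 2 + y ^+ 2 by rewrite -sqrtr_gt0; exact: hypot_gt0.
have ds := is_derive1_sqrt s0.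
have dp : is_derive y (1 : R) (fun y : R => x ^+ 2 + y ^+ 2) (y *+ 2).
  apply: is_derive_eq.
  by rewrite /GRing.scale /= !mulr1 add0r mul1r.
have := is_derive1_comp (g := fun y : R => x ^+ 2 + y ^+ 2) ds dp.
congr is_derive; rewrite -mulr_natl /G.
have := hypot_gt0 y; rewrite /G => /gt_eqF/negbT; move: (Num.sqrt _) => s sn0.
by field.
Qed.

Lemma continuous_hypot_slope : continuous (fun y : R => y / G y).
Proof.
move=> y; apply: cvgM; first exact: cvg_id.
apply: cvgV; first by rewrite gt_eqF// hypot_gt0.
apply: differentiable_continuous; apply/derivable1_diffP.
by case: (is_derive_hypot y).
Qed.

Variable f : R -> \bar R.
Hypotheses (mf : measurable_fun setT f) (f0 : forall y, (0 <= f y)%E).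

(** Half of the passage to polar coordinates, at fixed abscissa [x]: substitute
    [rho = sqrt (x ^+ 2 + y ^+ 2)] for [y].  For [x != 0] the slope of this
    function of [y] is continuous up to [y = 0]. *)
Lemma ge0_integral_hypot :
  (\int[mu]_(y in `]0%R, +oo[) f y =
   \int[mu]_(rho in `](`|x|)%R, +oo[)
     (f (Num.sqrt (rho ^+ 2 - x ^+ 2)) *
      (rho / Num.sqrt (rho ^+ 2 - x ^+ 2))%:E))%E.
Proof.
(* The norm on rho only serves to make this function nonnegative on the whole
   line. *)
pose K (rho : R) : \bar R := (f (Num.sqrt (rho ^+ 2 - x ^+ 2)) *
      (`|rho| / Num.sqrt (rho ^+ 2 - x ^+ 2))%:E)%E.
have mK : measurable_fun setT K.
  have mS : measurable_fun setT (fun rho : R => Num.sqrt (rho ^+ 2 - x ^+ 2)).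
    by apply: measurableT_comp (@measurable_sqrt R) _; exact: measurable_funB.
  apply: emeasurable_funM; first exact: measurableT_comp mf mS.
  apply/measurable_EFinP; apply: measurable_funM => //.
  exact: measurableT_comp (@measurable_invr R) mS.
have K0 rho : (0 <= K rho)%E by rewrite mule_ge0// lee_fin divr_ge0.
have KG y : 0 < y -> (K (G y) * (y / G y)%:E = f y)%E.
  move=> y0; have G0 := hypot_gt0 y; rewrite /K -muleA -EFinM.
  have -> : Num.sqrt (G y ^+ 2 - x ^+ 2) = y.
    by rewrite /G sqr_sqrtr ?addr_ge0 ?sqr_ge0// addrC addKr sqrtr_sqr gtr0_norm.
  rewrite gtr0_norm// (_ : G y / y * (y / G y) = 1) ?mule1//.
  by rewrite mulrA divfK ?mulfV ?gt_eqF.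
have mKG : measurable_fun setT (fun y => K (G y) * (y / G y)%:E)%E.
  apply: emeasurable_funM.
    apply: measurableT_comp mK _; apply: continuous_measurable_fun.
    exact: continuous_primitive is_derive_hypot.
  apply/measurable_EFinP; apply: continuous_measurable_fun.
  exact: continuous_hypot_slope.
transitivity (\int[mu]_(y in `]0%R, +oo[) (K (G y) * (y / G y)%:E))%E.
  by apply: eq_integral => y; rewrite inE/= in_itv/= andbT => /KG.
(* KG fails at y = 0, where the slope vanishes, so the end point is
   put back only after it has been used. *)
rewrite integral_itv_obnd_cbnd; last exact: measurable_funTS.
have G0 : G 0 = `|x| by rewrite /G expr0n/= addr0 sqrtr_sqr.
rewrite -(ge0_substitution_cy is_derive_hypot continuous_hypot_slope mK K0).
- rewrite G0 -integral_itv_obnd_cbnd; last exact: measurable_funTS.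
  apply: eq_integral => rho; rewrite inE/= in_itv/= andbT => xrho.
  by rewrite /K gtr0_norm// (le_lt_trans _ xrho).
- move=> y z; rewrite !in_itv/= !andbT => y0 z0 yz.
  rewrite ltr_sqrt; last by rewrite -sqrtr_gt0; exact: hypot_gt0.
  by rewrite ltrD2l ltr_sqr ?nnegrE.
- by move=> y y0; rewrite divr_ge0// sqrtr_ge0.
- move=> d; exists `|d| => //.
  rewrite (le_trans (ler_norm d))// -[leLHS]sqrtr_sqr /G.
  by rewrite ler_wsqrtr// real_normK ?num_real// lerDr sqr_ge0.
Qed.

End slice.

Section half_plane.
Context (R : realType).
Notation mu := (@lebesgue_measure R).

Variable f : M2 R -> \bar R.
Hypotheses (mf : measurable_fun setT f) (f0 : forall z, (0 <= f z)%E).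

Let K (z : M2 R) : \bar R := (f (z.1, Num.sqrt (z.2 ^+ 2 - z.1 ^+ 2)) *
  (`|z.2| / Num.sqrt (z.2 ^+ 2 - z.1 ^+ 2))%:E)%E.

Let mK : measurable_fun setT K.
Proof.
have mS : measurable_fun setT (fun z : M2 R => Num.sqrt (z.2 ^+ 2 - z.1 ^+ 2)).
  apply: measurableT_comp (@measurable_sqrt R) _; apply: measurable_funB.
  - by apply: measurable_funX; exact: measurable_snd.
  - by apply: measurable_funX; exact: measurable_fst.
apply: emeasurable_funM.
  apply: measurableT_comp mf _.
  by apply: measurable_fun_pair => //; exact: measurable_fst.
apply/measurable_EFinP; apply: measurable_funM => //.
  by apply: measurableT_comp => //; exact: measurable_snd.
exact: measurableT_comp (@measurable_invr R) mS.
Qed.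

Let K0 z : (0 <= K z)%E.
Proof. by rewrite mule_ge0// lee_fin divr_ge0. Qed.

Let slice_x x :
  (\int[mu]_(y in `]0%R, +oo[) f (x, y) =
   \int[mu]_(rho in `](`|x|)%R, +oo[) K (x, rho))%E.
Proof.
have [->|x0] := eqVneq x 0.
  rewrite normr0; apply: eq_integral => y; rewrite inE/= in_itv/= andbT => y0.
  by rewrite /K/= expr0n/= subr0 sqrtr_sqr gtr0_norm// divff ?mule1// gt_eqF.
rewrite (ge0_integral_hypot x0 (f := fun y => f (x, y)))//.
  apply: eq_integral => y; rewrite inE/= in_itv/= andbT => xy.
  by rewrite /K/= gtr0_norm// (le_lt_trans _ xy).
exact: measurableT_comp mf (pair1_measurable x).
Qed.

Let slice_rho rho : 0 < rho ->
  (\int[mu]_(x in `](- rho)%R, rho[) K (x, rho) =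
   \int[mu]_(theta in `[0%R, pi])
     (f (rho * cos theta, rho * sin theta)%R * rho%:E))%E.
Proof.
move=> rho0.
have mKr : measurable_fun setT (fun x => K (x, rho)).
  exact: measurableT_comp mK (pair2_measurable rho).
have mKrN : measurable_fun setT (fun x : R => K (- x, rho)).
  by apply: measurableT_comp mKr _; exact: measurable_funN.
(* cos is decreasing on [0, pi]: reflect x, then substitute - rho * cos theta. *)
transitivity (\int[mu]_(x in `](- rho)%R, rho[) K (- x, rho)%R)%E.
  rewrite integral_mkcond -ge0_integral_opp.
  - rewrite [RHS]integral_mkcond; apply: eq_integral => x _.
    rewrite !patchE (_ : (- x \in _) = (x \in `](- rho), rho[%classic))//.
    by apply/idP/idP; rewrite !inE/= !in_itv/= => /andP[? ?]; lra.
  - apply/(measurable_restrictT _ (measurable_itv _)).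
    exact: measurable_funTS.
  - by move=> x; rewrite patchE; case: ifP.
pose G (t : R) := - rho * cos t.
have dG (t : R) : is_derive t (1 : R) G (rho * sin t).
  rewrite /G; apply: is_derive_eq.
  by rewrite /GRing.scale /= mulrNN.
have cg : continuous (fun t : R => rho * sin t).
  by move=> t; apply: cvgM; [exact: cvg_cst|exact: continuous_sin].
have G0 : G 0 = - rho by rewrite /G cos0 mulr1.
have Gpi : G pi = rho by rewrite /G cospi mulrN1 opprK.
have pi0 := @pi_ge0 R.
rewrite -(@integral_itv_bndoo _ _ _ _ true false); last exact: measurable_funTS.
rewrite -{1}G0 -{1}Gpi (ge0_substitution_cc dG cg mKrN)//; first last.
- by move=> t /sin_ge0_pi s0; rewrite mulr_ge0// ltW.
- move=> s t sI tI st; rewrite /G !mulNr ltrN2 ltr_pM2l//.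
  by rewrite ltr_cos.
have mT : measurable_fun setT
    (fun t : R => f (rho * cos t, rho * sin t)%R * rho%:E)%E.
  apply: emeasurable_funM => //; apply: measurableT_comp mf _.
  by apply: measurable_fun_pair; apply: measurable_funM => //;
    apply: continuous_measurable_fun; [exact: continuous_cos|exact: continuous_sin].
have mKG : measurable_fun setT
    (fun t : R => K (- G t, rho)%R * (rho * sin t)%:E)%E.
  apply: emeasurable_funM.
    apply: measurableT_comp mKrN _; apply: continuous_measurable_fun.
    exact: continuous_primitive dG.
  by apply/measurable_EFinP; exact: continuous_measurable_fun.
rewrite integral_itv_bndoo; last exact: measurable_funTS.
rewrite [RHS]integral_itv_bndoo; last exact: measurable_funTS.
apply: eq_integral => t; rewrite inE/= in_itv/= => tI.
have st := sin_gt0_pi tI.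
have rs : 0 < rho * sin t by rewrite mulr_gt0.
rewrite /K/= /G mulNr opprK.
have -> : rho ^+ 2 - (rho * cos t) ^+ 2 = (rho * sin t) ^+ 2.
  by rewrite !exprMn sin2cos2 mulrBr mulr1.
rewrite sqrtr_sqr !gtr0_norm// -muleA -EFinM divfK ?gt_eqF//.
Qed.

(** Exchange the integrals over the cone [|x| < rho] between the substitutions
    at fixed [x] and at fixed [rho].  The factor
    [rho / sqrt (rho ^+ 2 - x ^+ 2)] of the former and the factor
    [rho * sin theta] of the latter multiply to [rho]. *)
Lemma ge0_polar_half_plane :
  (\int[mu]_x \int[mu]_(y in `]0%R, +oo[) f (x, y) =
   \int[mu]_(rho in `]0%R, +oo[) \int[mu]_(theta in `[0%R, pi])
     (f (rho * cos theta, rho * sin theta)%R * rho%:E))%E.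
Proof.
pose A : set (M2 R) := [set z | `|z.1| < z.2].
have mA : measurable A.
  have mF : measurable_fun setT (fun z : M2 R => z.2 - `|z.1|).
    apply: measurable_funB; first exact: measurable_snd.
    by apply: measurableT_comp (@normr_measurable R setT) _; exact: measurable_fst.
  have -> : A = setT `&` (fun z : M2 R => z.2 - `|z.1|) @^-1` `]0, +oo[.
    by apply/seteqP; split=> z /=; rewrite /A/= in_itv/= andbT subr_gt0// => -[].
  exact: mF.
transitivity (\int[mu]_x \int[mu]_(rho in xsection A x) K (x, rho))%E.
  apply: eq_integral => x _; rewrite slice_x; congr (integral _ _ _).
  by apply/seteqP; split=> y; rewrite /xsection/= inE/A/= in_itv/= andbT.
rewrite (ge0_fubini_sections lebesgue_measure lebesgue_measure mA mK K0).
rewrite [RHS]integral_mkcond; apply: eq_integral => rho _; rewrite patchE.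
case: ifPn => [|]; rewrite ?inE ?notin_setE/= in_itv/= andbT => rho0.
  rewrite -slice_rho//; congr (integral _ _ _).
  by apply/seteqP; split=> x; rewrite /ysection/= inE/A/= in_itv/= ltr_norml.
rewrite (_ : ysection A rho = set0) ?integral_set0//.
apply/seteqP; split=> x //; rewrite /ysection/= inE/A/= => xrho.
by apply: rho0; exact: le_lt_trans xrho.
Qed.

End half_plane.

Section plane.
Context (R : realType).
Notation mu := (@lebesgue_measure R).
Variable f : M2 R -> \bar R.
Hypotheses (mf : measurable_fun setT f) (f0 : forall z, (0 <= f z)%E).

Let m1 x : measurable_fun setT (fun y => f (x, y)).
Proof. exact: measurableT_comp mf (pair1_measurable x). Qed.

Lemma ge0_integral_shift2 (a : R * R) :
  (\int[mu2]_z f (z.1 + a.1, z.2 + a.2)%R = \int[mu2]_z f z)%E.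
Proof.
have mfs : measurable_fun setT (fun z : M2 R => f (z.1 + a.1, z.2 + a.2)).
  apply: measurableT_comp mf _; apply: measurable_fun_pair.
    by apply: measurable_funD => //; exact: measurable_fst.
  by apply: measurable_funD => //; exact: measurable_snd.
rewrite (@fubini_tonelli1 _ _ _ _ _ lebesgue_measure lebesgue_measure _ mfs)//.
rewrite [RHS](@fubini_tonelli1 _ _ _ _ _ lebesgue_measure lebesgue_measure
  _ mf)//.
rewrite -[RHS](@ge0_integral_shift _ _ _ _ a.1); last 2 first.
- exact: measurable_fun_fubini_tonelli_F.
- by move=> x; exact: integral_ge0.
apply: eq_integral => x _; rewrite /fubini_F/=.
exact: (ge0_integral_shift (m1 (x + a.1)) _ a.2).
Qed.

Let mopp : measurable_fun setT (fun z : M2 R => f (- z.1, - z.2)).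
Proof.
apply: measurableT_comp mf _; apply: measurable_fun_pair.
  by apply: measurable_funN; exact: measurable_fst.
by apply: measurable_funN; exact: measurable_snd.
Qed.

Let mpolar (r : R) :
  measurable_fun setT (fun t : R => f (r * cos t, r * sin t)%R * r%:E)%E.
Proof.
apply: emeasurable_funM => //; apply: measurableT_comp mf _.
by apply: measurable_fun_pair; apply: measurable_funM => //;
  apply: continuous_measurable_fun; [exact: continuous_cos|exact: continuous_sin].
Qed.

Let m2polar (g : M2 R -> \bar R) : measurable_fun setT g ->
  measurable_fun setT (fun z : M2 R =>
    g (z.1 * cos z.2, z.1 * sin z.2)%R * `|z.1|%:E)%E.
Proof.
move=> mg; apply: emeasurable_funM.
  apply: measurableT_comp mg _; apply: measurable_fun_pair.
  - apply: measurable_funM; first exact: measurable_fst.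
    apply: measurableT_comp (continuous_measurable_fun (@continuous_cos R)) _.
    exact: measurable_snd.
  - apply: measurable_funM; first exact: measurable_fst.
    apply: measurableT_comp (continuous_measurable_fun (@continuous_sin R)) _.
    exact: measurable_snd.
apply/measurable_EFinP.
by apply: measurableT_comp (@normr_measurable R setT) _; exact: measurable_fst.
Qed.

(** The lower half-plane is the image of the upper one under [z |-> - z], which
    adds [pi] to the angle. *)
Lemma ge0_polar :
  (\int[mu2]_z f z =
   \int[mu]_(rho in `]0%R, +oo[) \int[mu]_(phi in `[0%R, (2 * pi)%R])
     (f (rho * cos phi, rho * sin phi)%R * rho%:E))%E.
Proof.
apply: (etrans (@fubini_tonelli1 _ _ _ _ _ lebesgue_measure lebesgue_measure
  f mf f0)).
have half x : (\int[mu]_y f (x, y) = \int[mu]_(y in `]0%R, +oo[) f (x, y) +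
    \int[mu]_(y in `]0%R, +oo[) f (x, - y)%R)%E.
  have mN : measurable_fun setT (fun y : R => f (x, - y)).
    by apply: measurableT_comp (m1 x) _; exact: measurable_funN.
  rewrite (_ : [set: R] = `]0, +oo[ `|` `]-oo, 0]); last first.
    apply/seteqP; split=> // y _ /=; rewrite !in_itv/= andbT.
    by case: (ltP 0 y) => _; [left|right].
  rewrite ge0_integral_setU//; last 2 first.
  - exact: measurable_funTS.
  - apply/disj_setPS => y /=; rewrite !in_itv/= andbT => -[y0].
    by rewrite leNgt y0.
  congr (_ + _)%E; rewrite integral_itv_obnd_cbnd; last exact: measurable_funTS.
  rewrite ge0_integration_by_substitution0//.
  by apply: eq_integral => y _; rewrite opprK.
transitivity (\int[mu]_x (\int[mu]_(y in `]0%R, +oo[) f (x, y) +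
    \int[mu]_(y in `]0%R, +oo[) f (x, - y)%R))%E.
  by apply: eq_integral => x _; exact: half.
have mfN : measurable_fun setT (fun z : M2 R => f (z.1, - z.2)).
  apply: measurableT_comp mf _; apply: measurable_fun_pair.
    exact: measurable_fst.
  by apply: measurable_funN; exact: measurable_snd.
have mS (g : M2 R -> \bar R) (mg : measurable_fun setT g)
    (g0 : forall z, (0 <= g z)%E) :
    measurable_fun setT (fun x : R => \int[mu]_(y in `]0%R, +oo[) g (x, y))%E.
  exact: (measurable_section_integral mu (measurable_itv _) mg g0).
have mSN := mS _ mfN (fun z => f0 _).
rewrite ge0_integralD//; first last.
- by move=> x _; exact: integral_ge0.
- exact: mS.
- by move=> x _; exact: integral_ge0.
rewrite -[X in (_ + X)%E](ge0_integral_opp mSN); last first.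
  by move=> x; exact: integral_ge0.
rewrite (ge0_polar_half_plane mf f0) (ge0_polar_half_plane mopp)//.
have mfabs := m2polar mf; have moabs := m2polar mopp.
have mI (g : M2 R -> \bar R) (b : R) :
    measurable_fun setT g -> (forall z, 0 <= g z)%E ->
    measurable_fun (`]0, +oo[%classic : set R) (fun r : R => \int[mu]_(t in `[0%R, b])
      (g (r * cos t, r * sin t)%R * r%:E))%E.
  move=> mg g0.
  have h0 (z : M2 R) : (0 <= g (z.1 * cos z.2, z.1 * sin z.2)%R * `|z.1|%:E)%E.
    by rewrite mule_ge0// lee_fin.
  have mh := measurable_section_integral mu (measurable_itv `[0%R, b])
    (m2polar mg) h0.
  apply: (eq_measurable_fun _ _ (measurable_funTS mh)) => r.
  rewrite inE/= in_itv/= andbT => r0.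
  by apply: eq_integral => t _; rewrite gtr0_norm.
rewrite -ge0_integralD//; first last.
- exact: mI mopp _.
- move=> r /=; rewrite in_itv/= andbT => r0.
  by apply: integral_ge0 => t _; rewrite mule_ge0// lee_fin ltW.
- exact: mI mf _.
- move=> r /=; rewrite in_itv/= andbT => r0.
  by apply: integral_ge0 => t _; rewrite mule_ge0// lee_fin ltW.
apply: eq_integral => r; rewrite inE/= in_itv/= andbT => r0.
have pi0 := @pi_gt0 R.
rewrite (_ : `[0, 2 * pi]%classic = `[0, pi] `|` `]pi, 2 * pi] :> set R); last first.
  apply/seteqP; split=> t /=; rewrite !in_itv/=.
    by move=> /andP[t0 t2]; case: (leP t pi) => tp; [left|right]; lra.
  by case=> /andP[? ?]; lra.
rewrite ge0_integral_setU//; first last.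
- apply/disj_setPS => y /=; rewrite !in_itv/= => -[/andP[_ y0]].
  by rewrite ltNge y0.
- by move=> t _; rewrite mule_ge0// lee_fin ltW.
- exact: measurable_funTS (mpolar r).
congr (_ + _)%E; rewrite integral_itv_obnd_cbnd; last first.
  exact: measurable_funTS (mpolar r).
rewrite [RHS]integral_mkcond -(ge0_integral_shift _ _ pi); first last.
- move=> t; rewrite patchE; case: ifP => // _.
  by rewrite mule_ge0// lee_fin ltW.
- apply/(measurable_restrictT _ (measurable_itv _)).
  exact: measurable_funTS (mpolar r).
rewrite [LHS]integral_mkcond; apply: eq_integral => t _.
rewrite !patchE (_ : (t + pi \in `[pi, 2 * pi]%classic) = (t \in `[0, pi]%classic)).
  by rewrite cosDpi sinDpi !mulrN.
by apply/idP/idP; rewrite !inE/= !in_itv/= => /andP[? ?]; lra.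
Qed.

End plane.

Section space.
Context (R : realType).
Notation mu := (@lebesgue_measure R).
Notation nu2 := (sf_product mu mu).
Variable f : M3 R -> \bar R.
Hypotheses (mf : measurable_fun setT f) (f0 : forall z, (0 <= f z)%E).

Lemma ge0_integral3 :
  (\int[mu3]_y f y = \int[mu]_z \int[mu2]_x f (x, z))%E.
Proof.
exact: (@fubini_tonelli2 _ _ _ _ _ nu2 lebesgue_measure f mf f0).
Qed.

Lemma measurable_cos_comp d (T : measurableType d) (g : T -> R) :
  measurable_fun setT g -> measurable_fun setT (fun x => cos (g x)).
Proof.
move=> mg.
exact: measurableT_comp (continuous_measurable_fun (@continuous_cos R)) mg.
Qed.

Lemma measurable_sin_comp d (T : measurableType d) (g : T -> R) :
  measurable_fun setT g -> measurable_fun setT (fun x => sin (g x)).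
Proof.
move=> mg.
exact: measurableT_comp (continuous_measurable_fun (@continuous_sin R)) mg.
Qed.

Lemma ge0_spherical_origin :
  (\int[mu3]_y f y =
   \int[mu]_(rho in `]0%R, +oo[) \int[mu2]_(t in sphere_dom)
     (f (sphere_param (0, 0)%R rho t) * (rho ^+ 2 * sin t.1)%:E))%E.
Proof.
(* w is the pair of the height and the distance to the vertical axis; F w is
   the integral of f over the circle that they determine. *)
pose F (w : M2 R) : \bar R := (\int[mu]_(phi in `[0%R, (2 * pi)%R])
  (f ((w.2 * cos phi)%R, (w.2 * sin phi)%R, w.1) * `|w.2|%:E))%E.
have mcyl : measurable_fun setT (fun q : M2 R * measurableTypeR R =>
    f ((q.1.2 * cos q.2)%R, (q.1.2 * sin q.2)%R, q.1.1) * `|q.1.2|%:E)%E.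
  have m12 : measurable_fun setT (fun q : M2 R * measurableTypeR R => q.1.2).
    exact: measurableT_comp (measurable_snd) (measurable_fst).
  have m2 : measurable_fun setT (fun q : M2 R * measurableTypeR R => q.2).
    exact: measurable_snd.
  apply: emeasurable_funM.
    apply: measurableT_comp mf _; apply: measurable_fun_pair.
      apply: measurable_fun_pair; apply: measurable_funM => //.
        exact: measurable_cos_comp.
      exact: measurable_sin_comp.
    exact: measurableT_comp (measurable_fst) (measurable_fst).
  apply/measurable_EFinP.
  exact: measurableT_comp (@normr_measurable R setT) m12.
have cyl0 (q : M2 R * measurableTypeR R) :
    (0 <= f ((q.1.2 * cos q.2)%R, (q.1.2 * sin q.2)%R, q.1.1) * `|q.1.2|%:E)%E.
  by rewrite mule_ge0// lee_fin.
have mF : measurable_fun setT F.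
  exact: (measurable_section_integral mu (measurable_itv `[0%R, (2 * pi)%R])
    mcyl cyl0).
have F0 w : (0 <= F w)%E by apply: integral_ge0 => phi _; exact: (cyl0 (w, phi)).
rewrite ge0_integral3.
transitivity (\int[mu]_z \int[mu]_(s in `]0%R, +oo[) F (z, s))%E.
  apply: eq_integral => z _.
  have mfz : measurable_fun setT (fun x : M2 R => f (x, z)).
    exact: measurableT_comp mf (pair2_measurable z).
  apply: (etrans (ge0_polar mfz (fun x => f0 (x, z)))).
  apply: eq_integral => s; rewrite inE/= in_itv/= andbT => s0.
  by apply: eq_integral => phi _; rewrite gtr0_norm.
rewrite ge0_polar_half_plane//.
apply: eq_integral => rho; rewrite inE/= in_itv/= andbT => rho0.
have mcap : measurable_fun setT (fun t : M2 R =>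
    f (sphere_param (0, 0)%R rho t) * `|rho ^+ 2 * sin t.1|%:E)%E.
  apply: emeasurable_funM.
    apply: measurableT_comp mf _; apply: measurable_fun_pair.
      apply: measurable_fun_pair; apply: measurable_funD => //;
      apply: measurable_funM => //.
      + apply: measurable_funM => //; exact: measurable_sin_comp.
      + exact: measurable_cos_comp.
      + apply: measurable_funM => //; exact: measurable_sin_comp.
      + exact: measurable_sin_comp.
    by apply: measurable_funM => //; exact: measurable_cos_comp.
  apply/measurable_EFinP.
  apply: measurableT_comp (@normr_measurable R setT) _.
  by apply: measurable_funM => //; exact: measurable_sin_comp.
transitivity (\int[mu2]_(t in sphere_dom)
  (f (sphere_param (0, 0)%R rho t) * `|rho ^+ 2 * sin t.1|%:E))%E; last first.
  apply: eq_integral => t; rewrite inE => -[/= t1 _].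
  by rewrite ger0_norm// mulr_ge0 ?sqr_ge0// sin_ge0_pi.
rewrite (@ge0_integral_setX _ _ _ _ _ mu mu `[0, pi] `[0, (2 * pi)] _ _ _ mcap)//.
  apply: eq_integral => theta; rewrite inE/= => thetaI.
  have s0 : 0 <= sin theta by exact: sin_ge0_pi.
  rewrite /F/= muleC -ge0_integralZl//; first last.
  - by rewrite lee_fin ltW.
  - by move=> phi _; exact: (cyl0 ((rho * cos theta, rho * sin theta), phi)%R).
  - apply: measurable_funTS.
    exact: measurableT_comp mcyl
      (pair1_measurable ((rho * cos theta, rho * sin theta)%R : M2 R)).
  apply: eq_integral => phi _; rewrite /sphere_param/= !add0r muleCA -EFinM.
  by rewrite !ger0_norm ?mulr_ge0 ?sqr_ge0 ?(ltW rho0)// mulrA -expr2.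
by move=> t; rewrite mule_ge0// lee_fin.
Qed.

End space.

Section translated.
Context (R : realType).
Notation mu := (@lebesgue_measure R).
Variable f : M3 R -> \bar R.
Hypotheses (mf : measurable_fun setT f) (f0 : forall z, (0 <= f z)%E).

Lemma ge0_spherical (x' : R * R) :
  (\int[mu3]_y f y =
   \int[mu]_(rho in `]0%R, +oo[) \int[mu2]_(t in sphere_dom)
     (f (sphere_param x' rho t) * (rho ^+ 2 * sin t.1)%:E))%E.
Proof.
pose g (y : M3 R) := f (y.1.1 + x'.1, y.1.2 + x'.2, y.2).
have mg : measurable_fun setT g.
  apply: measurableT_comp mf _; apply: measurable_fun_pair.
    apply: measurable_fun_pair; apply: measurable_funD => //.
      exact: measurableT_comp (measurable_fst) (measurable_fst).
    exact: measurableT_comp (measurable_snd) (measurable_fst).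
  exact: measurable_snd.
transitivity (\int[mu3]_y g y)%E.
  rewrite (ge0_integral3 mf f0) (ge0_integral3 mg (fun y => f0 _)).
  apply: eq_integral => z _; apply/esym.
  apply: (ge0_integral_shift2 (f := fun x => f (x, z))) => //.
  exact: measurableT_comp mf (pair2_measurable z).
apply: (etrans (ge0_spherical_origin mg (fun y => f0 _))).
apply: eq_integral => rho _; apply: eq_integral => t _.
by rewrite /g /sphere_param/= !add0r !(addrC _ x'.1) !(addrC _ x'.2).
Qed.

End translated.

(** * Borel sets and test functions *)

Section borel_space.
Context (R : realType).

Let rat_ball (i : rat * rat * rat * nat) : set (R3 R) :=
  let: (a, b, c, n) := i in ball ((ratr a, ratr b, ratr c) : R3 R) n.+1%:R^-1.

Let measurable_rat_ball i : measurable (rat_ball i : set (M3 R)).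
Proof.
move: i => [[[a b] c] n] /=.
have -> : ball ((ratr a, ratr b, ratr c) : R3 R) n.+1%:R^-1 =
    ball (ratr a : R) n.+1%:R^-1 `*` ball (ratr b : R) n.+1%:R^-1 `*`
    ball (ratr c : R) n.+1%:R^-1 by [].
by apply: measurableX; [apply: measurableX|]; exact: measurable_ball.
Qed.

(** The product sigma-algebra contains the open sets because balls with rational
    data, which are boxes, form a countable base of the topology. *)
Lemma open_measurable3 (U : set (R3 R)) :
  open U -> measurable (U : set (M3 R)).
Proof.
move=> oU.
have -> : U = \bigcup_(i in [set: rat * rat * rat * nat])
    (if `[< rat_ball i `<=` U >] then rat_ball i else set0).
  apply/seteqP; split=> [x Ux|x [i _]]; last first.
    by case: asboolP => // + xi; exact.
  have /nbhs_ballP[e /= e0 xeU] : nbhs x U by exact: open_nbhs_nbhs.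
  have /ltr_add_invr[n] : 0 < e / 2 by rewrite divr_gt0.
  rewrite add0r => ne.
  have n0 : 0 < n.+1%:R^-1 :> R by rewrite invr_gt0.
  have near_rat (y : R) : exists q : rat, ball y n.+1%:R^-1 (ratr q).
    have [|q] := @rat_in_itvoo R (y - n.+1%:R^-1) (y + n.+1%:R^-1).
      by rewrite ltrBlDr -addrA ltrDl addr_gt0.
    rewrite in_itv/= => /andP[q1 q2]; exists q.
    by rewrite /ball/= ltr_distlC q1 q2.
  have [a xa] := near_rat x.1.1; have [b xb] := near_rat x.1.2.
  have [c xc] := near_rat x.2.
  have xq : ball x n.+1%:R^-1 ((ratr a, ratr b, ratr c) : R3 R) by split=> //; split.
  exists (a, b, c, n) => //; case: asboolP => [_|[]].
    exact: ball_sym.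
  move=> y yq; apply: xeU; rewrite (splitr e).
  by apply: ball_triangle; [exact: (le_ball (ltW ne) xq)|exact: (le_ball (ltW ne) yq)].
apply: countable_bigcupT_measurable => //.
by move=> i; case: asboolP.
Qed.

Lemma closed_measurable3 (U : set (R3 R)) :
  closed U -> measurable (U : set (M3 R)).
Proof.
move=> cU; rewrite -(setCK U); apply: measurableC; apply: open_measurable3.
exact: closed_openC.
Qed.

Lemma continuous_measurable3 (f : R3 R -> R) :
  continuous f -> measurable_fun [set: M3 R] f.
Proof.
move=> cf; apply: (measurability _ (RGenOpens.measurableE R)).
move=> _ [_ [a [b ->]] <-]; rewrite setTI; apply: open_measurable3.
by move/continuousP : cf; apply; exact: interval_open.
Qed.

End borel_space.

Section axis3.
Context (R : realType).

Lemma is_derive_axis3 (f : R3 R -> R) (x' : R * R) (r : R) :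
  derivable f (x', r) (unit_vec axis3) ->
  is_derive r (1 : R) (fun t => f (x', t)) (partial axis3 f (x', r)).
Proof.
have e3 : unit_vec axis3 = (0, 0, 1) :> R3 R by [].
have E : (fun h : R =>
      h^-1 *: ((f \o shift (x', r)) (h *: unit_vec axis3) - f (x', r))) =
    (fun h : R =>
      h^-1 *: (((fun t => f (x', t)) \o shift r) (h *: (1 : R)) - f (x', r))).
  apply/funext => h; rewrite e3 /=; congr (_ *: (f _ - _)).
  case: x' => a b; rewrite /shift/=.
  by congr (_, _, _); rewrite /= scaler0 add0r.
move=> df; apply: DeriveDef.
  by move: df; rewrite /derivable E.
by rewrite /partial /derive E.
Qed.

Lemma continuous_vertical (f : R3 R -> R) (x' : R * R) :
  continuous f -> continuous (fun r : R => f (x', r)).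
Proof.
move=> cf r.
apply: (@cvg_comp _ _ _ (fun s : R => (x', s)) f _ (nbhs (x', r))); last exact: cf.
have cx : (fun _ : R => x') s @[s --> r] --> x' by exact: cvg_cst.
have cs : (fun s : R => s) s @[s --> r] --> r by exact: cvg_id.
exact: (cvg_pair cx cs).
Qed.

(** Each point outside of the closed set [K] has a neighbourhood on which the
    function vanishes. *)
Lemma partial_eq0 (i : 'I_3) (K : set (R3 R)) (f : R3 R -> R) :
  closed K -> (forall x, ~ K x -> f x = 0) ->
  forall x, ~ K x -> partial i f x = 0.
Proof.
move=> cK f0 x Kx; rewrite /partial (near_eq_derive (g := cst 0)).
  exact: derive_cst.
have : nbhs x (~` K) by apply: open_nbhs_nbhs; split=> //; exact: closed_openC.
by apply: filterS => y /f0.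
Qed.

Lemma continuous_compact_support_bounded (K : set (R3 R)) (f : R3 R -> R) :
  compact K -> continuous f -> (forall x, ~ K x -> f x = 0) ->
  exists C, forall x, `|f x| <= C.
Proof.
move=> cK cf f0.
have /compact_bounded/ex_strict_bound_gt0[C C0 fC] : compact (f @` K).
  by apply: continuous_compact => //; exact: continuous_subspaceT.
exists C => x; have [Kx|Kx] := pselect (K x).
  by apply/ltW/fC; exists x.
by rewrite f0// normr0 ltW.
Qed.

Lemma compact_closed3 (K : set (R3 R)) : compact K -> closed K.
Proof. by apply: compact_closed; exact: (@norm_hausdorff R (R3 R)). Qed.

(** These boxes exhaust [data_domain].  They touch its boundary [r = 0], because
    a radial primitive takes its values from all the radii below [r]. *)
Definition half_box (M : R) : set (R3 R) :=
  (`]- M, M[ `*` `]- M, M[) `*` `]0, M[.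

Lemma measurable_half_box M : measurable (half_box M : set (M3 R)).
Proof. by apply: measurableX => //; exact: measurableX. Qed.

Lemma compact_half_box (K : set (R3 R)) :
  compact K -> K `<=` data_domain -> exists2 M, 0 < M & K `<=` half_box M.
Proof.
move=> /compact_bounded/ex_strict_bound_gt0[M M0 KM] Kpos.
exists M => // x Kx; have /= := KM _ Kx.
rewrite !prod_normE/= !gt_max => /andP[/andP[x1 x2] x3].
have x0 : 0 < x.2 by exact: Kpos.
rewrite /half_box; split; first split; rewrite /= in_itv/= -?ltr_norml//.
by rewrite x0 (le_lt_trans (ler_norm _) x3).
Qed.

End axis3.

(** * The weak derivative of a primitive *)

Section line.
Context (R : realType).
Notation mu := (@lebesgue_measure R).

(** Integration by parts for an integrable [s] that need not be continuous: both
    sides are iterated integrals of [s rho * psi r] over the triangle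
    [0 < rho < r < M], the inner integral of [psi] over [`]rho, M[] being
    [- phi rho]. *)
Lemma integral_primitive_derive (M C : R) (s phi psi : R -> R) :
  0 <= M -> mu.-integrable setT (EFin \o s) ->
  (forall r : R, is_derive r (1 : R) phi (psi r)) -> continuous psi ->
  (forall r, `|psi r| <= C) ->
  (forall r, ~~ (0 < r < M) -> psi r = 0) ->
  (forall r, ~~ (0 < r < M) -> phi r = 0) ->
  (\int[mu]_r ((\int[mu]_(rho in `]0%R, r[) s rho)%R * psi r)%:E =
   \int[mu]_rho (- (s rho * phi rho))%:E)%E.
Proof.
move=> M0 si dphi cpsi psiC psi0 phi0.
have ms : measurable_fun setT s by apply/measurable_EFinP; exact: measurable_int si.
have mpsi : measurable_fun setT psi by exact: continuous_measurable_fun.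
pose D : set (M2 R) := [set z | 0 < z.2 /\ z.2 < z.1 < M].
have mD : measurable D.
  have -> : D = setT `&` (fun z : M2 R => Num.min z.2 (Num.min (z.1 - z.2) (M - z.1)))
      @^-1` `]0, +oo[.
    apply/seteqP; split=> z /=; rewrite /D/= in_itv/= andbT !lt_min !subr_gt0.
      by move=> [-> /andP[-> ->]].
    by move=> [_ /and3P[-> -> ->]].
  have m1 : measurable_fun setT (fun z : M2 R => z.1) by exact: measurable_fst.
  have m2 : measurable_fun setT (fun z : M2 R => z.2) by exact: measurable_snd.
  have mF : measurable_fun setT
      (fun z : M2 R => Num.min z.2 (Num.min (z.1 - z.2) (M - z.1))).
    by do 2 (apply: measurable_minr => //); exact: measurable_funB.
  exact: mF.
pose A : M2 R -> \bar R := (fun z : M2 R => (s z.2 * psi z.1)%:E) \_ D.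
have mA : measurable_fun setT A.
  apply/(measurable_restrictT _ mD)/measurable_funTS/measurable_EFinP.
  apply: measurable_funM.
    exact: measurableT_comp ms (measurable_snd).
  exact: measurableT_comp mpsi (measurable_fst).
have C0 : 0 <= C by exact: le_trans (psiC 0).
have iA : (mu \x mu)%E.-integrable setT A.
  apply/(integrable21ltyP mu mu mA).
  apply: (@le_lt_trans _ _ (\int[mu]_rho ((C * M)%:E * `|(s rho)%:E|))%E).
    apply: ge0_le_integral => //.
    - by move=> rho _; exact: integral_ge0.
    - apply: (measurable_fun_fubini_tonelli_G (abse \o A)).
        by apply: (@measurableT_comp _ _ _ _ _ _ abse) => //.
      by move=> z; exact: abse_ge0.
    - by apply: emeasurable_funM => //; apply/measurableT_comp/measurable_EFinP.
    - move=> rho _.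
      apply: (@le_trans _ _ (\int[mu]_(r in `]0%R, M[) (cst (C * `|s rho|)%:E) r))%E.
        rewrite [leRHS]integral_mkcond; apply: ge0_le_integral => //.
        + apply: measurableT_comp => //.
          exact: measurableT_comp mA (pair2_measurable rho).
        + apply/(measurable_restrictT _ (measurable_itv _)).
          exact: measurable_cst.
        + move=> r _; rewrite /A !patchE.
          case: ifPn => [|_]; last first.
            by rewrite abse0; case: ifP => // _; rewrite lee_fin mulr_ge0.
          rewrite inE /D/= => -[rho0 /andP[rhor rM]].
          rewrite ifT; last by rewrite inE/= in_itv/= rM (lt_trans rho0).
          by rewrite lee_fin normrM mulrC ler_wpM2r.
      rewrite integral_cst// [X in (_ * X)%E]lebesgue_measure_itv/= lte_fin.
      case: ifPn => [_|]; last by rewrite mule0 mule_ge0// lee_fin mulr_ge0.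
      by rewrite -EFinB -!EFinM subr0 lee_fin mulrAC.
  rewrite ge0_integralZl//; last by rewrite lee_fin mulr_ge0.
    apply: lte_mul_pinfty; rewrite ?lee_fin ?mulr_ge0//.
    by case/integrableP : si.
  by apply/measurableT_comp/measurable_EFinP.
have := etrans (integral12_prod_meas1 iA) (esym (integral21_prod_meas1 iA)).
rewrite /fubini_F /fubini_G.
have si' (E : set R) : measurable E -> mu.-integrable E (EFin \o s).
  by move=> mE; exact: integrableS si.
have -> : (\int[mu]_x \int[mu]_y A (x, y) =
    \int[mu]_r ((\int[mu]_(rho in `]0%R, r[) s rho)%R * psi r)%:E)%E.
  apply: eq_integral => r _.
  have [rI|rI] := boolP (0 < r < M); last first.
    rewrite psi0// mulr0 integral0_eq// => rho _; rewrite /A patchE ifF//.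
    apply/negbTE; rewrite notin_setE /D/= => -[rho0 /andP[rhor rM]].
    by move/negP : rI; apply; rewrite rM (lt_trans rho0).
  rewrite EFinM fineK; last by apply: integrable_fin_num => //; exact: si'.
  rewrite muleC -integralZl//; last exact: si'.
  rewrite [RHS]integral_mkcond; apply: eq_integral => rho _.
  rewrite /A !patchE (_ : (_ \in D) = (rho \in `]0, r[%classic)).
    by rewrite /= mulrC EFinM.
  case/andP : rI => r0 rM.
  by apply/idP/idP; rewrite !inE/= in_itv/= /D/= rM andbT => /andP.
move=> ->; apply: eq_integral => rho _.
have [rI|rI] := boolP (0 < rho < M); last first.
  rewrite phi0// mulr0 oppr0 integral0_eq// => r _; rewrite /A patchE ifF//.
  apply/negbTE; rewrite notin_setE /D/= => -[rho0 /andP[rhor rM]].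
  by move/negP : rI; apply; rewrite rho0 (lt_trans rhor).
case/andP : rI => r0 rM.
transitivity (\int[mu]_(r in `]rho, M[) ((s rho)%:E * (psi r)%:E))%E.
  rewrite [RHS]integral_mkcond; apply: eq_integral => r _.
  rewrite /A !patchE (_ : (_ \in D) = (r \in `]rho, M[%classic)) ?EFinM//.
  apply/idP/idP; rewrite !inE/= in_itv/= /D/=; first by case.
  by [].
have ipsi : mu.-integrable `]rho, M[ (EFin \o psi).
  apply: (@integrableS _ _ _ mu `[rho, M]) => //.
    exact: subset_itv_oo_cc.
  apply: continuous_compact_integrable; first exact: segment_compact.
  exact: continuous_subspaceT.
rewrite integralZl// integral_itv_obnd_cbnd; last first.
  exact/measurable_funTS/measurable_EFinP.
rewrite (integral_bndo_derive dphi cpsi (ltW rM)) (phi0 M) ?ltxx ?andbF//.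
by rewrite -EFinM sub0r mulrN.
Qed.

End line.

Section primitive.
Context (R : realType).
Notation mu := (@lebesgue_measure R).
Notation nu2 := (sf_product mu mu).
Variable w : R3 R -> R.
Hypothesis mw : measurable_fun [set: M3 R] w.
Hypothesis wbox : forall M : R, 0 < M ->
  (\int[mu3]_(p in half_box M) `|w p|%:E < +oo)%E.

Let mew : measurable_fun [set: M3 R] (fun p => `|w p|%:E).
Proof. exact/measurable_EFinP/measurableT_comp. Qed.

Definition radial_primitive (p : R3 R) : R :=
  \int[mu]_(rho in `]0, p.2[) w (p.1, rho).

Lemma measurable_radial_primitive : measurable_fun [set: M3 R] radial_primitive.
Proof.
pose D : set (M3 R * measurableTypeR R) := [set q | 0 < q.2 < q.1.2].
have m2 : measurable_fun setT (fun q : M3 R * measurableTypeR R => q.2).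
  exact: measurable_snd.
have m12 : measurable_fun setT (fun q : M3 R * measurableTypeR R => q.1.2).
  exact: measurableT_comp (measurable_snd) (measurable_fst).
have m11 : measurable_fun setT (fun q : M3 R * measurableTypeR R => q.1.1).
  exact: measurableT_comp (measurable_fst) (measurable_fst).
have mD : measurable D.
  have -> : D = setT `&` (fun q : M3 R * measurableTypeR R =>
      Num.min q.2 (q.1.2 - q.2)) @^-1` `]0, +oo[.
    apply/seteqP; split=> z /=; rewrite /D/= in_itv/= andbT lt_min subr_gt0//.
    by case.
  have mF : measurable_fun setT (fun q : M3 R * measurableTypeR R =>
      Num.min q.2 (q.1.2 - q.2)).
    by apply: measurable_minr => //; exact: measurable_funB.
  exact: mF.
pose W : M3 R * measurableTypeR R -> \bar R := (fun q => (w (q.1.1, q.2))%:E) \_ D.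
have mW : measurable_fun setT W.
  apply/(measurable_restrictT _ mD)/measurable_funTS/measurable_EFinP.
  by apply: measurableT_comp mw _; exact: measurable_fun_pair.
rewrite (_ : radial_primitive = fine \o (fun p => \int[mu]_rho W (p, rho))%E).
  by apply: measurableT_comp; [exact: fine_measurable|exact: measurable_integral].
apply/funext => p; rewrite /radial_primitive /Rintegral/= integral_mkcond.
congr fine; apply: eq_integral => rho _; rewrite /W !patchE.
Qed.

Let V (M : R) (x : M2 R) := (\int[mu]_(rho in `]0%R, M[) `|w (x, rho)|%:E)%E.

Let mV M : measurable_fun setT (V M).
Proof.
apply: (measurable_section_integral mu (measurable_itv `]0%R, M[) mew).
by move=> p; rewrite lee_fin.
Qed.

Let V0 M x : (0 <= V M x)%E.
Proof. exact: integral_ge0. Qed.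

Let boxV M : (\int[mu3]_(p in half_box M) `|w p|%:E =
  \int[mu2]_(x in `](- M)%R, M[ `*` `](- M)%R, M[) V M x)%E.
Proof.
apply: (@ge0_integral_setX _ _ _ _ _ nu2 mu _ _ (fun p => `|w p|%:E)%E) => //.
exact: measurableX.
Qed.

(** Stated with extended reals, so that it holds also on the vertical lines
    where [w] is not integrable. *)
Lemma radial_primitive_le M (p : R3 R) : half_box M p ->
  (`|radial_primitive p|%:E <= V M p.1)%E.
Proof.
move=> [_]; rewrite /= in_itv/= => /andP[p0 pM].
have mwp : measurable_fun setT (fun rho : R => w (p.1, rho)).
  exact: measurableT_comp mw (pair1_measurable p.1).
rewrite -abse_EFin.
apply: (@le_trans _ _ `|\int[mu]_(rho in `]0%R, p.2[) (w (p.1, rho))%:E|%E).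
  rewrite /radial_primitive /Rintegral.
  by case: (integral _ _ _) => [r| |] //=; rewrite normr0 leey.
apply: le_trans (le_abse_integral _ _ _) _ => //.
  exact/measurable_funTS/measurable_EFinP.
apply: ge0_subset_integral => //.
  by apply/measurable_funTS/measurable_EFinP/measurableT_comp.
by move=> rho /=; rewrite !in_itv/= => /andP[-> /lt_trans->].
Qed.

Lemma radial_primitive_box M : 0 < M ->
  (\int[mu3]_(p in half_box M) `|radial_primitive p|%:E < +oo)%E.
Proof.
move=> M0; have mF := measurable_radial_primitive.
pose V' (p : M3 R) := V M p.1.
have mV' : measurable_fun setT V'.
  exact: measurableT_comp (mV M) (measurable_fst).
apply: (@le_lt_trans _ _ (\int[mu3]_(p in half_box M) V' p)%E).
  apply: ge0_le_integral => //.
  - exact: measurable_half_box.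
  - exact/measurable_funTS/measurable_EFinP/measurableT_comp.
  - exact: measurable_funTS.
  - by move=> p; exact: radial_primitive_le.
rewrite (@ge0_integral_setX _ _ _ _ _ nu2 mu _ _ V')//; last 2 first.
- exact: measurableX.
- by move=> z; exact: V0.
rewrite (_ : (\int[nu2]_(x in _) _)%E =
    (\int[mu2]_(x in `](- M)%R, M[ `*` `](- M)%R, M[) (M%:E * V M x))%E).
  rewrite ge0_integralZl//; last 3 first.
  - exact: measurableX.
  - exact: measurable_funTS.
  - by rewrite lee_fin ltW.
  by apply: lte_mul_pinfty; rewrite ?lee_fin ?ltW// -boxV wbox.
apply: eq_integral => x _; rewrite /V'/= integral_cst//.
by rewrite [X in (_ * X)%E]lebesgue_measure_itv/= lte_fin M0 sube0 muleC.
Qed.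

Lemma L1loc_half_box (f : R3 R -> R) : measurable_fun [set: M3 R] f ->
  (forall M, 0 < M -> (\int[mu3]_(p in half_box M) `|f p|%:E < +oo)%E) ->
  L1loc data_domain f.
Proof.
move=> mf fbox; split; first exact: measurable_funTS.
move=> K Kd cK; have [M M0 KM] := compact_half_box cK Kd.
apply: le_lt_trans (fbox M M0); apply: ge0_subset_integral => //.
- by apply: closed_measurable3; exact: compact_closed3.
- exact: measurable_half_box.
- exact/measurable_funTS/measurable_EFinP/measurableT_comp.
Qed.

(** Fubini's theorem reduces the identity to almost every vertical line, where
    it is [integral_primitive_derive]. *)
Lemma weak_partial_primitive :
  is_weak_partial data_domain axis3 radial_primitive w.
Proof.
have mF := measurable_radial_primitive.
split; [|exact: L1loc_half_box|].
  exact: (L1loc_half_box mF radial_primitive_box).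
move=> phi [sphi [K [cK Kd phi0]]].
have [M M0 KM] := compact_half_box cK Kd.
have [cphi dphi] := sphi [::]; have [cpsi _] := sphi [:: axis3].
set psi := partial axis3 phi.
have psi0 : forall p, ~ K p -> psi p = 0.
  by apply: partial_eq0 => //; exact: compact_closed3.
have [Cphi phiC] := continuous_compact_support_bounded cK cphi phi0.
have [Cpsi psiC] := continuous_compact_support_bounded cK cpsi psi0.
have mphi : measurable_fun [set: M3 R] phi by exact: continuous_measurable3.
have mpsi : measurable_fun [set: M3 R] psi by exact: continuous_measurable3.
have restrict_dom (a f : R3 R -> R) : (forall p, ~ K p -> f p = 0) ->
    (\int[mu3]_(p in data_domain) (a p * f p)%:E =
     \int[mu3]_p (a p * f p)%:E)%E.
  move=> f0; rewrite integral_mkcond; apply: eq_integral => p _.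
  rewrite patchE; case: ifPn => //; rewrite notin_setE => pd.
  by rewrite f0 ?mulr0// => /Kd.
have int_mul (a f : R3 R -> R) C : measurable_fun [set: M3 R] a ->
    measurable_fun [set: M3 R] f ->
    (forall p, ~ K p -> f p = 0) -> (forall p, `|f p| <= C) ->
    (\int[mu3]_(p in half_box M) `|a p|%:E < +oo)%E ->
    (@mu3 R).-integrable setT (fun p => (a p * f p)%:E).
  move=> ma mf f0 fC afin; have C0 : 0 <= C by exact: le_trans (fC (0, 0, 0)).
  apply/integrableP; split; first exact/measurable_EFinP/measurable_funM.
  apply: (@le_lt_trans _ _ (\int[mu3]_(p in half_box M) (C%:E * `|a p|%:E))%E).
    rewrite [leRHS]integral_mkcond; apply: ge0_le_integral => //.
    - exact/measurableT_comp/measurable_EFinP/measurable_funM.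
    - apply/(measurable_restrictT _ (measurable_half_box M)).
      apply/measurable_funTS/measurable_EFinP/measurable_funM => //.
      exact: measurableT_comp.
    - move=> p _; rewrite patchE; case: ifPn => [_|].
        by rewrite -EFinM lee_fin normrM mulrC ler_wpM2r.
      by rewrite notin_setE => pb; rewrite f0 ?mulr0 ?abse0// => /KM.
  rewrite ge0_integralZl//.
  - by apply: lte_mul_pinfty; rewrite ?lee_fin.
  - exact: measurable_half_box.
  - by apply/measurable_funTS/measurable_EFinP/measurableT_comp.
have iFpsi := int_mul _ _ _ mF mpsi psi0 psiC (radial_primitive_box M0).
have iwphi := int_mul _ _ _ mw mphi phi0 phiC (wbox M0).
rewrite /Rintegral !restrict_dom//.
have -> : (\int[mu3]_p (radial_primitive p * psi p)%:E =
    \int[mu3]_p (- (w p * phi p))%:E)%E.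
  have iNwphi : (@mu3 R).-integrable setT (fun p => (- (w p * phi p))%:E).
    exact: integrableN iwphi.
  apply: (etrans (esym (@integral12_prod_meas1 _ _ _ _ _ nu2 mu _ iFpsi))).
  apply: (etrans _ (@integral12_prod_meas1 _ _ _ _ _ nu2 mu _ iNwphi)).
  apply: ae_eq_integral => //.
  - exact: (@measurable_fubini_F _ _ _ _ _ nu2 mu _ iFpsi).
  - exact: (@measurable_fubini_F _ _ _ _ _ nu2 mu _ iNwphi).
  (* Only the values of w on a box that contains the support of phi matter; the
     truncation to it is integrable on almost every vertical line. *)
  pose wM : R3 R -> R := w \_ (half_box M).
  have mbox := @measurable_half_box R M.
  have iwM : (nu2 \x mu)%E.-integrable setT (fun p => (wM p)%:E).
    apply/integrableP; split.
      by apply/measurable_EFinP/(measurable_restrictT _ mbox)/measurable_funTS.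
    have := wbox M0; rewrite integral_mkcond; apply: le_lt_trans.
    rewrite le_eqVlt; apply/orP; left; apply/eqP; apply: eq_integral => p _.
    by rewrite /wM !patchE; case: ifP => //; rewrite abse0.
  have := ae_integrable1 iwM; apply: filterS => x ix _.
  have off_box t : ~ half_box M (x, t) -> phi (x, t) = 0 /\ psi (x, t) = 0.
    by move=> xt; split; [apply: phi0|apply: psi0] => /KM.
  have off_itv t : ~~ (0 < t < M) -> ~ half_box M (x, t).
    by move=> tM [_]; rewrite /= in_itv/=; exact/negP.
  have := @integral_primitive_derive R M Cpsi (fun t => wM (x, t))
    (fun t => phi (x, t)) (fun t => psi (x, t)) (ltW M0) ix.
  rewrite /fubini_F => H; apply: etrans (etrans (H _ _ _ _ _) _).
  - apply: eq_integral => t _; congr (_%:E).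
    have [xt|/off_box[_ ->]] := pselect (half_box M (x, t)); last by rewrite !mulr0.
    congr (_ * _); apply: eq_Rintegral => rho; rewrite inE/= in_itv/= => /andP[r0 rt].
    rewrite /wM patchE ifT// inE; case: xt => xQ; rewrite /= in_itv/= => /andP[_ tM].
    by split => //=; rewrite in_itv/= r0 (lt_trans rt).
  - by move=> t; exact: is_derive_axis3.
  - exact: continuous_vertical.
  - by move=> t; exact: psiC.
  - by move=> t /off_itv/off_box[].
  - by move=> t /off_itv/off_box[].
  apply: eq_integral => t _; congr (- _)%:E.
  have [xt|/off_box[-> _]] := pselect (half_box M (x, t)); last by rewrite !mulr0.
  by rewrite /wM patchE ifT// inE.
by rewrite -fineN; congr fine; rewrite -integralN//; exact: integrable_add_def.
Qed.

End primitive.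

(** * Integrals over spheres and balls *)

Section shell.
Context (R : realType).
Notation mu := (@lebesgue_measure R).
Notation nu2 := (sf_product mu mu).

Lemma measurable_sphere_dom : measurable (sphere_dom : set (M2 R)).
Proof. exact: measurableX. Qed.

Lemma sphere_param_norm (x' : R * R) rho (t : R * R) :
  let y := sphere_param x' rho t in
  (y.1.1 - x'.1) ^+ 2 + (y.1.2 - x'.2) ^+ 2 + y.2 ^+ 2 = rho ^+ 2.
Proof.
rewrite /sphere_param/= !(addrC x'.1) !(addrC x'.2) !addrK !exprMn -mulrDr.
by rewrite [cos t.2 ^+ 2 + _]cos2Dsin2 mulr1 -mulrDr addrC cos2Dsin2 mulr1.
Qed.

(** The integral of [k] over the sphere of centre [(p.1, 0)] and radius [p.2],
    with the area element written out as [p.2 ^+ 2 * sin t.1]. *)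
Definition shell (k : R3 R -> R) (p : R3 R) : \bar R :=
  (\int[mu2]_(t in sphere_dom)
     (k (sphere_param p.1 p.2 t) * (p.2 ^+ 2 * sin t.1))%:E)%E.

Variable k : R3 R -> R.
Hypotheses (mk : measurable_fun [set: M3 R] k).

Lemma measurable_shell : measurable_fun [set: M3 R] (shell k).
Proof.
pose T := (M3 R * M2 R)%type.
have m1 : measurable_fun setT (fun q : T => q.1) by exact: measurable_fst.
have m2 : measurable_fun setT (fun q : T => q.2) by exact: measurable_snd.
have m111 : measurable_fun setT (fun q : T => q.1.1.1).
  exact: measurableT_comp measurable_fst (measurableT_comp measurable_fst m1).
have m112 : measurable_fun setT (fun q : T => q.1.1.2).
  exact: measurableT_comp measurable_snd (measurableT_comp measurable_fst m1).
have m12 : measurable_fun setT (fun q : T => q.1.2).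
  exact: measurableT_comp measurable_snd m1.
have m21 : measurable_fun setT (fun q : T => q.2.1).
  exact: measurableT_comp measurable_fst m2.
have m22 : measurable_fun setT (fun q : T => q.2.2).
  exact: measurableT_comp measurable_snd m2.
have ms1 := measurable_sin_comp m21. have mc1 := measurable_cos_comp m21.
have ms2 := measurable_sin_comp m22. have mc2 := measurable_cos_comp m22.
have mD : measurable (setT `*` sphere_dom : set T).
  by apply: measurableX => //; exact: measurable_sphere_dom.
pose f : T -> \bar R := (fun q =>
  (k (sphere_param q.1.1 q.1.2 q.2) * (q.1.2 ^+ 2 * sin q.2.1))%:E)
  \_ (setT `*` sphere_dom).
have mf : measurable_fun setT f.
  apply/(measurable_restrictT _ mD)/measurable_funTS/measurable_EFinP.
  apply: measurable_funM.
    apply: measurableT_comp mk _; apply: measurable_fun_pair.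
      apply: measurable_fun_pair; apply: measurable_funD => //;
      by do 2 (apply: measurable_funM => //).
    exact: measurable_funM.
  by apply: measurable_funM => //; exact: measurable_funX.
rewrite (_ : shell k = fun p => \int[nu2]_t f (p, t))%E.
  exact: measurable_integral.
apply/funext => p; rewrite /shell integral_mkcond; apply: eq_integral => t _.
by rewrite /f !patchE in_setX in_setT.
Qed.

Hypothesis k0 : forall y, 0 <= k y.

Lemma shell_ge0 p : (0 <= shell k p)%E.
Proof.
apply: integral_ge0 => t [t1 _].
have s0 : 0 <= sin t.1 by exact: sin_ge0_pi.
rewrite lee_fin; apply: mulr_ge0; first exact: k0.
by apply: mulr_ge0 => //; exact: sqr_ge0.
Qed.

Lemma measurable_wall_ball (x' : R * R) r :
  measurable (wall_ball x' r : set (M3 R)).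
Proof.
have [r0|r0] := ltP 0 r; last first.
  rewrite (_ : wall_ball x' r = set0)//; apply/seteqP; split=> y //= [].
  by rewrite ltNge r0.
have m1 : measurable_fun setT (fun y : M3 R => y.1.1).
  exact: measurableT_comp (measurable_fst) (measurable_fst).
have m2 : measurable_fun setT (fun y : M3 R => y.1.2).
  exact: measurableT_comp (measurable_snd) (measurable_fst).
have m3 : measurable_fun setT (fun y : M3 R => y.2) by exact: measurable_snd.
have -> : wall_ball x' r = setT `&` (fun y : M3 R =>
    (y.1.1 - x'.1) ^+ 2 + (y.1.2 - x'.2) ^+ 2 + y.2 ^+ 2) @^-1` `]-oo, r ^+ 2[.
  by apply/seteqP; split=> y /=; rewrite in_itv/= => -[].
have mF : measurable_fun setT (fun y : M3 R =>
    (y.1.1 - x'.1) ^+ 2 + (y.1.2 - x'.2) ^+ 2 + y.2 ^+ 2).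
  apply: measurable_funD; first apply: measurable_funD; apply: measurable_funX => //;
    exact: measurable_funB.
exact: mF.
Qed.

(** Spherical coordinates applied to [k] cut off outside of the ball. *)
Lemma integral_wall_ball (x' : R * R) r : 0 < r ->
  (\int[mu3]_(y in wall_ball x' r) (k y)%:E =
   \int[mu]_(rho in `]0%R, r[) shell k (x', rho))%E.
Proof.
move=> r0; have mB := measurable_wall_ball x' r.
rewrite integral_mkcond.
have mf : measurable_fun setT ((EFin \o k) \_ (wall_ball x' r) : M3 R -> \bar R).
  exact/(measurable_restrictT _ mB)/measurable_funTS/measurable_EFinP.
have f0 y : (0 <= ((EFin \o k) \_ (wall_ball x' r)) y)%E.
  by rewrite patchE; case: ifP => // _; rewrite lee_fin.
apply: (etrans (ge0_spherical mf f0 x')).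
rewrite integral_mkcond [RHS]integral_mkcond; apply: eq_integral => rho _.
rewrite !patchE; case: ifPn => [|rho0]; last first.
  rewrite ifF//; apply/negbTE; apply: contraNN rho0.
  by rewrite !inE/= !in_itv/= andbT => /andP[].
rewrite inE/= in_itv/= andbT => rho0.
have ball_iff t : (sphere_param x' rho t \in wall_ball x' r) = (rho < r).
  apply/idP/idP; rewrite inE /wall_ball/= sphere_param_norm.
    by move=> [_]; rewrite ltr_sqr ?nnegrE ?ltW.
  by move=> ?; split=> //; rewrite ltr_sqr ?nnegrE ?ltW.
rewrite (_ : (rho \in `]0, r[%classic) = (rho < r)); last first.
  by apply/idP/idP; rewrite !inE/= in_itv/= rho0.
case: ifPn => rhor.
  by apply: eq_integral => t _; rewrite patchE ball_iff rhor /= EFinM.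
by apply: integral0_eq => t _; rewrite patchE ball_iff (negbTE rhor) mul0e.
Qed.

Definition cube (M : R) : set (R3 R) := `[- M, M] `*` `[- M, M] `*` `[- M, M].

Lemma compact_cube M : compact (cube M).
Proof.
by apply: compact_setX; [apply: compact_setX|]; exact: segment_compact.
Qed.

Lemma measurable_cube M : measurable (cube M : set (M3 R)).
Proof. by apply: measurableX => //; exact: measurableX. Qed.

Lemma wall_ball_cube (x' : R * R) M r :
  x'.1 \in `]- M, M[ -> x'.2 \in `]- M, M[ -> r <= M -> wall_ball x' r `<=` cube (M + M).
Proof.
rewrite !in_itv/= => /andP[x1 x1'] /andP[x2 x2'] rM y [r0 yr].
have sq (a : R) : a ^+ 2 < r ^+ 2 -> - r < a < r.
  rewrite -ltr_norml -(ltr_sqr (normr_ge0 a)) ?nnegrE ?(ltW r0)//.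
  by rewrite real_normK ?num_real.
have s1 := sqr_ge0 (y.1.1 - x'.1); have s2 := sqr_ge0 (y.1.2 - x'.2).
have s3 := sqr_ge0 y.2.
have /sq/andP[? ?] : (y.1.1 - x'.1) ^+ 2 < r ^+ 2 by lra.
have /sq/andP[? ?] : (y.1.2 - x'.2) ^+ 2 < r ^+ 2 by lra.
have /sq/andP[? ?] : y.2 ^+ 2 < r ^+ 2 by lra.
by split; [split|]; rewrite /= in_itv/=; apply/andP; split; lra.
Qed.

Lemma wall_ball_bounded (x' : R * R) r : exists M, wall_ball x' r `<=` cube M.
Proof.
pose M := `|x'.1| + `|x'.2| + `|r| + 1.
have [n1 n2] : 0 <= `|x'.1| /\ 0 <= `|x'.2| by [].
have [n3 n4] : 0 <= `|r| /\ r <= `|r| by split=> //; exact: ler_norm.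
exists (M + M); apply: wall_ball_cube.
- by rewrite in_itv/= -ltr_norml /M; lra.
- by rewrite in_itv/= -ltr_norml /M; lra.
- by rewrite /M; lra.
Qed.

Hypothesis kcube : forall M, (\int[mu3]_(y in cube M) (k y)%:E < +oo)%E.

Lemma integral_wall_ball_le (x' : R * R) M r :
  x'.1 \in `]- M, M[ -> x'.2 \in `]- M, M[ -> r <= M ->
  (\int[mu3]_(y in wall_ball x' r) (k y)%:E <=
   \int[mu3]_(y in cube (M + M)) (k y)%:E)%E.
Proof.
move=> x1 x2 rM; apply: ge0_subset_integral.
- exact: measurable_wall_ball.
- exact: measurable_cube.
- exact/measurable_funTS/measurable_EFinP.
- by move=> y _; rewrite lee_fin.
- exact: wall_ball_cube.
Qed.

(** Over each centre [x'] the radial integral is an integral of [k] over a ball,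
    and all these balls lie in one cube. *)
Lemma shell_half_box M : 0 < M ->
  (\int[mu3]_(p in half_box M) shell k p < +oo)%E.
Proof.
move=> M0; have mQ : measurable (`]- M, M[ `*` `]- M, M[ : set (M2 R)).
  exact: measurableX.
rewrite (@ge0_integral_setX _ _ _ _ _ nu2 mu _ _ (shell k))//; last 2 first.
- exact: measurable_shell.
- exact: shell_ge0.
set C := (\int[mu3]_(y in cube (M + M)) (k y)%:E)%E.
have C0 : (0 <= C)%E by apply: integral_ge0 => y _; rewrite lee_fin.
apply: (@le_lt_trans _ _
  (\int[nu2]_(x in `](- M)%R, M[ `*` `](- M)%R, M[) cst C x)%E).
  apply: ge0_le_integral => //.
  - by move=> x _; apply: integral_ge0 => rho _; exact: shell_ge0.
  - apply: measurable_funTS; apply: measurable_section_integral => //.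
      exact: measurable_shell.
    exact: shell_ge0.
  - by move=> x [x1 x2]; rewrite -integral_wall_ball// integral_wall_ball_le.
rewrite integral_cst//.
rewrite [X in (_ * X)%E](_ : _ =
    mu `](- M)%R, M[%classic * mu `](- M)%R, M[%classic)%E; last first.
  exact: product_measure1E.
rewrite lte_mul_pinfty ?ge0_fin_numE ?kcube// [X in (X * X)%E]lebesgue_measure_itv/=.
by case: ifP => _; rewrite ?mule0 ?ltry// -EFinB -EFinM ltry.
Qed.

Lemma shell_line_fin (x' : R * R) r : 0 < r ->
  (\int[mu]_(rho in `]0%R, r[) shell k (x', rho) < +oo)%E.
Proof.
move=> r0; rewrite -integral_wall_ball//.
have [M ballM] := wall_ball_bounded x' r.
apply: le_lt_trans (kcube M); apply: ge0_subset_integral => //.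
- exact: measurable_wall_ball.
- exact: measurable_cube.
- exact/measurable_funTS/measurable_EFinP.
- by move=> y _; rewrite lee_fin.
Qed.

End shell.

(** * The divergence and its spherical means *)

Section spherical_derivative.
Context (R : realType).
Notation mu := (@lebesgue_measure R).
Notation nu2 := (sf_product mu mu).

Lemma surface_element (x' : R * R) r (t : R * R) : 0 < r -> sphere_dom t ->
  enorm (cross (derive_vec (fun s => sphere_param x' r (s, t.2)) t.1)
               (derive_vec (fun s => sphere_param x' r (t.1, s)) t.2)) =
  r ^+ 2 * sin t.1.
Proof.
move=> r0 [t1 _]; have s0 : 0 <= sin t.1 by exact: sin_ge0_pi.
case: t t1 s0 => a b /= _ s0.
have D1 (f : R -> R) (x d : R) : is_derive x (1 : R) f d -> derive1 f x = d.
  by move=> [_ <-]; rewrite derive1E.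
have d_sin (c k x : R) : derive1 (fun s => c + k * sin s) x = k * cos x.
  by apply: D1; apply: is_derive_eq; rewrite add0r mul1r.
have d_cos (c k x : R) : derive1 (fun s => c + k * cos s) x = k * - sin x.
  by apply: D1; apply: is_derive_eq; rewrite add0r mul1r.
rewrite /derive_vec /sphere_param /=.
rewrite (_ : (fun s => x'.1 + r * sin s * cos b) =
    fun s => x'.1 + r * cos b * sin s); last first.
  by apply/funext => s; rewrite mulrAC.
rewrite (_ : (fun s => x'.2 + r * sin s * sin b) =
    fun s => x'.2 + r * sin b * sin s); last first.
  by apply/funext => s; rewrite mulrAC.
rewrite (_ : (fun s => r * cos s) = fun s => 0 + r * cos s); last first.
  by apply/funext => s; rewrite add0r.
rewrite !d_sin !d_cos.
have -> : derive1 (fun=> r * cos a) b = 0 by rewrite derive1_cst.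
rewrite /cross /enorm/=.
set X := (X in Num.sqrt X).
have -> : X = (r ^+ 2 * sin a) ^+ 2.
  have c1 := cos2Dsin2 a; have c2 := cos2Dsin2 b; rewrite /X.
  transitivity (r ^+ 4 * sin a ^+ 2 * (sin a ^+ 2 * (cos b ^+ 2 + sin b ^+ 2)
    + cos a ^+ 2 * (cos b ^+ 2 + sin b ^+ 2) ^+ 2)); first by ring.
  by rewrite c2 expr1n !mulr1 (addrC (sin a ^+ 2)) c1; ring.
by rewrite sqrtr_sqr ger0_norm// mulr_ge0// sqr_ge0.
Qed.

Variable h : R3 R -> R.
Hypothesis mh : measurable_fun [set: M3 R] h.

Let hp (y : R3 R) := Num.max (h y) 0.
Let hn (y : R3 R) := Num.max (- h y) 0.

Let mhp : measurable_fun [set: M3 R] hp.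
Proof. exact: measurable_maxr. Qed.

Let mhn : measurable_fun [set: M3 R] hn.
Proof. by apply: measurable_maxr => //; exact: measurable_funN. Qed.

Let hp0 y : 0 <= hp y. Proof. by rewrite le_max lexx orbT. Qed.

Let hn0 y : 0 <= hn y. Proof. by rewrite le_max lexx orbT. Qed.

Lemma surface_integralE (p : R3 R) : 0 < p.2 ->
  surface_integral sphere_dom (sphere_param p.1 p.2) h =
  (shell hp p - shell hn p)%E.
Proof.
move=> p0; rewrite /surface_integral.
rewrite (eq_integral (fun t : M2 R => (h (sphere_param p.1 p.2 t) *
  (p.2 ^+ 2 * sin t.1))%:E)); last first.
  by move=> t; rewrite inE => td; rewrite surface_element.
have s0 (t : R * R) : sphere_dom t -> 0 <= p.2 ^+ 2 * sin t.1.
  by move=> [t1 _]; rewrite mulr_ge0 ?sqr_ge0// sin_ge0_pi.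
rewrite integralE; congr (_ - _)%E; apply: eq_integral => t; rewrite inE => td.
  by rewrite funeposE -EFin_max /hp maxr_pMl ?s0// mul0r.
by rewrite funenegE -EFinN -EFin_max /hn maxr_pMl ?s0// mul0r mulNr.
Qed.

Hypothesis hcube : forall M, (\int[mu3]_(y in cube M) `|h y|%:E < +oo)%E.

Let hpcube M : (\int[mu3]_(y in cube M) (hp y)%:E < +oo)%E.
Proof.
apply: le_lt_trans (hcube M); apply: ge0_le_integral => //.
- exact: measurable_cube.
- by move=> y _; rewrite lee_fin.
- exact/measurable_funTS/measurable_EFinP.
- exact/measurable_funTS/measurable_EFinP/measurableT_comp.
- by move=> y _; rewrite lee_fin ge_max ler_norm normr_ge0.
Qed.

Let hncube M : (\int[mu3]_(y in cube M) (hn y)%:E < +oo)%E.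
Proof.
apply: le_lt_trans (hcube M); apply: ge0_le_integral => //.
- exact: measurable_cube.
- by move=> y _; rewrite lee_fin.
- exact/measurable_funTS/measurable_EFinP.
- exact/measurable_funTS/measurable_EFinP/measurableT_comp.
- by move=> y _; rewrite lee_fin ge_max -normrN ler_norm normr_ge0.
Qed.

(** Taking [fine] of the two parts separately gives a real function everywhere;
    the value is meaningful where both are finite, that is almost everywhere. *)
Definition radial_derivative (p : R3 R) : R :=
  fine (shell hp p) - fine (shell hn p).

Lemma measurable_radial_derivative :
  measurable_fun [set: M3 R] radial_derivative.
Proof.
apply: measurable_funB; apply: measurableT_comp (@fine_measurable R setT _) _ => //;
exact: measurable_shell.
Qed.

Lemma radial_derivative_half_box M : 0 < M ->
  (\int[mu3]_(p in half_box M) `|radial_derivative p|%:E < +oo)%E.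
Proof.
move=> M0; apply: (@le_lt_trans _ _
    (\int[mu3]_(p in half_box M) (shell hp p + shell hn p))%E).
  apply: ge0_le_integral => //.
  - exact: measurable_half_box.
  - by apply/measurable_funTS/measurable_EFinP/measurableT_comp => //;
      exact: measurable_radial_derivative.
  - by apply: measurable_funTS; apply: emeasurable_funD; exact: measurable_shell.
  - move=> p _; apply: (@le_trans _ _ (`|shell hp p| + `|shell hn p|)%E).
      rewrite /radial_derivative.
      case: (shell hp p) => [a| |]; case: (shell hn p) => [b| |] //=;
        rewrite ?leey// -EFinD lee_fin ?subr0; exact: ler_normB.
    by rewrite !gee0_abs// shell_ge0.
rewrite ge0_integralD//; first last.
- by apply: measurable_funTS; exact: measurable_shell.
- by move=> p _; exact: shell_ge0.
- by apply: measurable_funTS; exact: measurable_shell.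
- by move=> p _; exact: shell_ge0.
- exact: measurable_half_box.
by apply: lte_add_pinfty; exact: shell_half_box.
Qed.

(** Finiteness holds almost everywhere on each box, hence on the union of
    countably many boxes that exhaust [data_domain]. *)
Lemma shell_fin_ae (k : R3 R -> R) : measurable_fun [set: M3 R] k ->
  (forall y, 0 <= k y) -> (forall M, \int[mu3]_(y in cube M) (k y)%:E < +oo)%E ->
  {ae (@mu3 R), forall p : R3 R, data_domain p -> shell k p \is a fin_num}.
Proof.
move=> mk k0 kcube.
have ae_box (n : nat) : {ae (@mu3 R), forall p : R3 R, half_box n.+1%:R p ->
    shell k p \is a fin_num}.
  apply: integrable_ae; first exact: measurable_half_box.
  apply/integrableP; split.
    by apply: measurable_funTS; exact: measurable_shell.
  under eq_integral do rewrite gee0_abs ?shell_ge0//.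
  exact: shell_half_box.
have : {ae (@mu3 R), forall (p : R3 R) (n : nat), half_box n.+1%:R p ->
    shell k p \is a fin_num}.
  exact: ae_foralln.
have FF := ae_filter_ringOfSetsType (@mu3 R).
apply: filterS => p H p0.
pose M := `|p.1.1| + `|p.1.2| + p.2; apply: (H (Num.trunc M)).
have [n1 n2] : 0 <= `|p.1.1| /\ 0 <= `|p.1.2| by [].
have pM := truncnS_gt M; rewrite /data_domain/= in p0.
split; first split; rewrite /= in_itv/= -?ltr_norml.
- by apply: le_lt_trans pM; rewrite /M; lra.
- by apply: le_lt_trans pM; rewrite /M; lra.
- by rewrite p0; apply: le_lt_trans pM; rewrite /M; lra.
Qed.

Lemma spherical_meanE : {ae (@mu3 R), forall p : R3 R, data_domain p ->
  ((4 * pi * p.2 ^+ 2)^-1 * radial_derivative p)%:E = spherical_mean h p.1 p.2}.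
Proof.
have := shell_fin_ae mhn hn0 hncube; have := shell_fin_ae mhp hp0 hpcube.
have FF := ae_filter_ringOfSetsType (@mu3 R).
apply: filterS2 => p Hp Hn p0.
rewrite /spherical_mean surface_integralE// /radial_derivative EFinM EFinB.
by rewrite !fineK; [|exact: Hn|exact: Hp].
Qed.

(** On every vertical line, not just on almost every one, the radial integrals
    of both parts of [h] are finite, which gives the identity at every point. *)
Lemma integral_wall_ball_primitive (p : R3 R) : 0 < p.2 ->
  \int[mu3]_(y in wall_ball p.1 p.2) h y = radial_primitive radial_derivative p.
Proof.
move=> p0; rewrite /radial_primitive /Rintegral.
have finR (k : R3 R -> R) : measurable_fun [set: M3 R] k -> (forall y, 0 <= k y) ->
    (forall M, \int[mu3]_(y in cube M) (k y)%:E < +oo)%E ->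
    mu.-integrable `]0, p.2[ (fun rho => (fine (shell k (p.1, rho)))%:E) /\
    (\int[mu]_(rho in `]0%R, p.2[) (fine (shell k (p.1, rho)))%:E =
     \int[mu3]_(y in wall_ball p.1 p.2) (k y)%:E)%E.
  move=> mk k0 kcube.
  have ms : measurable_fun setT (fun rho : R => shell k (p.1, rho)).
    exact: measurableT_comp (measurable_shell mk) (pair1_measurable p.1).
  have si : mu.-integrable `]0, p.2[ (fun rho => shell k (p.1, rho)).
    apply/integrableP; split; first exact: measurable_funTS.
    under eq_integral do rewrite gee0_abs ?shell_ge0//.
    exact: shell_line_fin.
  have mf : measurable_fun `]0, p.2[ (fun rho => (fine (shell k (p.1, rho)))%:E).
    apply/measurable_funTS/measurable_EFinP.
    exact: measurableT_comp (@fine_measurable R setT _) ms.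
  have mI : measurable (`]0, p.2[%classic : set (measurableTypeR R)) by [].
  have fin_ae : ae_eq mu `]0, p.2[%classic (fun rho => (fine (shell k (p.1, rho)))%:E)
      (fun rho => shell k (p.1, rho)).
    have := integrable_ae mI si; apply: filterS => rho H rhoI.
    by rewrite fineK//; exact: H.
  split; last first.
    rewrite integral_wall_ball//; apply: ae_eq_integral => //.
    exact: measurable_funTS.
  apply: (le_integrable mI _ _ si) => // rho _.
  by case: (shell k (p.1, rho)) => [r| |] //=; rewrite leey.
have [ip ep] := finR _ mhp hp0 hpcube; have [im en] := finR _ mhn hn0 hncube.
rewrite /radial_derivative.
under [in RHS]eq_integral do rewrite EFinB.
rewrite integralB//= ep en integralE; congr fine; congr (_ - _)%E.
- by apply: eq_integral => y _; rewrite funeposE /hp EFin_max.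
- by apply: eq_integral => y _; rewrite funenegE /hn EFin_max.
Qed.

End spherical_derivative.

Section divergence.
Context (R : realType).

Lemma weak_partialP (i : 'I_3) (f : R3 R -> R) :
  (exists v, is_weak_partial setT i f v) ->
  is_weak_partial setT i f (weak_partial i f).
Proof. by case=> v fv; exact: (xgetPex (fun=> 0) (ex_intro _ v fv)). Qed.

Lemma L1loc_sum n (f : 'I_n -> R3 R -> R) :
  (forall i, L1loc setT (f i)) -> L1loc setT (fun x => \sum_(i < n) f i x).
Proof.
elim: n f => [|n IH] f fL.
  under [X in L1loc _ X]eq_fun do rewrite big_ord0.
  split=> [|K _ cK]; first exact: measurable_cst.
  by under eq_integral do rewrite normr0; rewrite integral0 ltry.
have [mg gL] := IH (fun i => f (lift ord0 i)) (fun i => fL _).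
have [m0 f0] := fL ord0.
under [X in L1loc _ X]eq_fun do rewrite big_ord_recl.
split=> [|K KT cK]; first exact: measurable_funD.
have mK : measurable (K : set (M3 R)).
  by apply: closed_measurable3; exact: compact_closed3.
have := lte_add_pinfty (f0 K KT cK) (gL K KT cK); apply: le_lt_trans.
have mabs (k : R3 R -> R) : measurable_fun [set: M3 R] k ->
    measurable_fun (K : set (M3 R)) (fun y => `|k y|%:E).
  by move=> mk; exact/measurable_funTS/measurable_EFinP/measurableT_comp.
rewrite -ge0_integralD//; last 2 first.
- exact: mabs.
- exact: mabs.
apply: ge0_le_integral => //.
- by apply: mabs; exact: measurable_funD.
- by apply: emeasurable_funD; exact: mabs.
- by move=> y _; rewrite -EFinD lee_fin ler_normD.
Qed.

Lemma L1loc_weak_div (u : R3 R -> R3 R) : H1 u -> L1loc setT (weak_div u).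
Proof.
move=> hu; apply: L1loc_sum => i.
have [_ /(_ i)[v _ uv]] := hu i.
by have [] := weak_partialP (ex_intro _ v uv).
Qed.

End divergence.

Theorem lemma2p1 (R : realType) (u : R3 R -> R3 R) (hu : H1e u)
    (h : R3 R -> R) (hmeas : measurable_fun [set: M3 R] h)
    (hdiv : {ae mu3, forall y, h y = - weak_div u y}) :
  let g := forward u in
  exists2 w : R3 R -> R,
    is_weak_partial data_domain axis3 (fun p => p.2 ^+ 4 * g p) w &
    {ae mu3, forall p : R3 R, data_domain p ->
      ((4 * pi * p.2 ^+ 2)^-1 * w p)%:E = spherical_mean h p.1 p.2}.
Proof.
move=> g; have [mdiv divL] := L1loc_weak_div hu.1.
have eq_div (D : set (R3 R)) (G : R -> \bar R) :
    measurable (D : set (M3 R)) -> measurable_fun setT G ->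
    (\int[mu3]_(y in D) G (h y) = \int[mu3]_(y in D) G (- weak_div u y)%R)%E.
  move=> mD mG; apply: ae_eq_integral => //.
  - by apply: measurable_funTS; exact: measurableT_comp mG hmeas.
  - apply: measurable_funTS; apply: measurableT_comp mG _.
    exact: measurable_funN.
  - have FF := ae_filter_ringOfSetsType (@mu3 R).
    by apply: filterS hdiv => y /= hy _; rewrite hy.
have hcube M : (\int[mu3]_(y in cube M) `|h y|%:E < +oo)%E.
  rewrite (eq_div _ (fun a => `|a|%:E)) //.
  - under eq_integral do rewrite normrN.
    exact: divL (@subsetT _ _) (@compact_cube R M).
  - exact: measurable_cube.
  - by apply/measurable_EFinP; exact: normr_measurable.
exists (radial_derivative h); last exact: spherical_meanE.
have -> : (fun p => p.2 ^+ 4 * g p) = radial_primitive (radial_derivative h).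
  apply/funext => p; rewrite /g /forward.
  have [p0|p0] := ltP 0 p.2; last first.
    rewrite (_ : wall_ball p.1 p.2 = set0); last first.
      by apply/seteqP; split=> y //= []; rewrite ltNge p0.
    rewrite Rintegral_set0 !mulr0 /radial_primitive set_itv_ge ?Rintegral_set0//.
    by rewrite bnd_simp -leNgt.
  have idiv : (@mu3 R).-integrable (wall_ball p.1 p.2) (EFin \o weak_div u).
    have [M ballM] := wall_ball_bounded p.1 p.2.
    apply: (integrableS (measurable_cube M) (measurable_wall_ball _ _) ballM).
    apply/integrableP; split; first exact/measurable_funTS/measurable_EFinP.
    exact: divL (@subsetT _ _) (@compact_cube R M).
  rewrite -integral_wall_ball_primitive// /Rintegral (eq_div _ EFin)//.
  - rewrite mulrA mulrN mulfV ?mulN1r ?expf_neq0 ?gt_eqF// -fineN.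
    have mB := measurable_wall_ball p.1 p.2.
    congr fine; rewrite -integralN; last exact: (integrable_add_def mB idiv).
    by apply: eq_integral => y _; rewrite EFinN.
  - exact: measurable_wall_ball.
apply: weak_partial_primitive.
- exact: measurable_radial_derivative.
- exact: radial_derivative_half_box.
Qed.
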